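(* Let $M$ be a transitive model of ZFC such that, in $M$, $\langle\gamma_n\colon n<\omega\rangle$ is a strictly increasing sequence of infinite cardinals with supremum $\gamma$ and $\mathcal D$ is a function with domain $\{(0,0)\}\cup\{(n,\alpha)\colon 0<n<\omega,\ \alpha<\gamma_{n-1}\}$ such that $\mathcal D(0,0)$ is a $\gamma_0$-complete ultrafilter on $\gamma_0$, each $\mathcal D(n,\alpha)$ is a $\gamma_n$-complete ultrafilter on $\gamma_n$, and $\mathcal D(n,\alpha)\neq\mathcal D(n,\beta)$ for $\alpha\ne\beta$. Let $S\colon\omega\to\gamma$ satisfy $S(n)<\gamma_n$ for all $n<\omega$. Then $S$ is a $(\mathbb P_{\mathcal D})^M$-generic sequence over $M$ if and only if for each $\mathcal D$-choice function $F\in M$ there is $0<n<\omega$ such that $S(i)\in F(i,S(i-1))$ for all $i$ with $n\le i<\omega$.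
   Context: A $\mathcal D$-choice function is a function $F$ with $\mathrm{dom}(F)=\mathrm{dom}(\mathcal D)$ and $F(x)\in\mathcal D(x)$. The forcing $\mathbb P_{\mathcal D}$ consists of pairs $(s,F)$ with $s$ a finite strictly increasing sequence of ordinals, $|s|>0$, $s(i)<\gamma_i$ for $i<|s|$, and $F$ a $\mathcal D$-choice function; $(s',F')$ is stronger than $(s,F)$ iff $|s|\le|s'|$, $s'\restriction|s|=s$, $F'(x)\subseteq F(x)$ for all $x\in\mathrm{dom}(\mathcal D)$, and $s'(i)\in F(i,s'(i-1))$ for $|s|\le i<|s'|$. $(\mathbb P_{\mathcal D})^M$ is this forcing computed in $M$. If $G$ is $(\mathbb P_{\mathcal D})^M$-generic over $M$, its generic sequence is $g=\bigcup\{s\colon\exists F\ (s,F)\in G\}$; $S$ is a generic sequence over $M$ if it is the generic sequence of some such $G$.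
   Formalization: The formal theorem additionally assumes that S is strictly increasing; without this the claim fails, since generic sequences are strictly increasing while the criterion constrains only a tail of S. *)

(* Defs.v *)
Set Implicit Arguments.
Unset Strict Implicit.
Unset Printing Implicit Defensive.

(** A structure for the language of set theory.  Every set-theoretic notion
    below is a first-order property of an arbitrary such structure [U].  "The
    notion holds in [M]" is the notion taken at [U := inner M], so that its
    quantifiers range over [M] only. *)

Record structure := Structure {
  carrier :> Type;
  mem : carrier -> carrier -> Prop
}.

Declare Scope sets_scope.
Notation "x ∈ y" := (mem x y) (at level 70, no associativity) : sets_scope.
Notation "x ∉ y" := (~ mem x y) (at level 70, no associativity) : sets_scope.
Local Open Scope sets_scope.

Section Notions.
Variable U : structure.
Implicit Types (a b d f i k m n p q u v w x y z A I W X : U).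

Definition subset x y := forall z, z ∈ x -> z ∈ y.
Definition empty x := forall z, z ∉ x.
Definition nonempty x := exists z, z ∈ x.

(** [y = x ∪ {x}] *)
Definition succ x y := forall z, z ∈ y <-> z ∈ x \/ z = x.

Definition upair a b p := forall z, z ∈ p <-> z = a \/ z = b.

(** [p = (a, b)], the Kuratowski pair *)
Definition pair a b p :=
  exists u v, upair a a u /\ upair a b v /\ upair u v p.

(** [(x, y) ∈ f], that is [f(x) = y] when [f] is a function *)
Definition app f x y := exists p, pair x y p /\ p ∈ f.

(** [f(x, x') = y] *)
Definition app2 f x x' y := exists p, pair x x' p /\ app f p y.

Definition function f :=
  (forall p, p ∈ f -> exists x y, pair x y p) /\
  (forall x y y', app f x y -> app f x y' -> y = y').

Definition dom f d := forall x, x ∈ d <-> exists y, app f x y.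

Definition function_on f d := function f /\ dom f d.

Definition maps f a b := function_on f a /\ (forall x y, app f x y -> y ∈ b).

Definition bijection f a b :=
  maps f a b /\
  (forall x x' y, app f x y -> app f x' y -> x = x') /\
  (forall y, y ∈ b -> exists x, app f x y).

Definition transitive x := forall y, y ∈ x -> subset y x.

Definition ordinal x :=
  transitive x /\
  (forall y z, y ∈ x -> z ∈ x -> y ∈ z \/ y = z \/ z ∈ y) /\
  (forall u, subset u x -> nonempty u ->
     exists y, y ∈ u /\ forall z, z ∈ u -> z ∉ y).

(** [x <= y] for ordinals *)
Definition le x y := x ∈ y \/ x = y.

Definition limit x :=
  ordinal x /\ nonempty x /\ (forall y, y ∈ x -> exists z, z ∈ x /\ y ∈ z).

Definition is_omega w := limit w /\ (forall n, n ∈ w -> ~ limit n).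

Definition cardinal x :=
  ordinal x /\ (forall a, a ∈ x -> ~ exists f, bijection f a x).

Definition infinite_cardinal w x := cardinal x /\ subset w x.

(** strictly increasing, for functions with ordinal arguments and values *)
Definition increasing f :=
  forall i j x y, app f i x -> app f j y -> i ∈ j -> x ∈ y.

(** [b] is the supremum of the values of [f] *)
Definition supremum f b :=
  ordinal b /\
  (forall n x, app f n x -> le x b) /\
  (forall b', ordinal b' -> (forall n x, app f n x -> le x b') -> le b b').

Definition inter2 X Y Z := forall x : U, x ∈ Z <-> x ∈ X /\ x ∈ Y.
Definition complement k X Y := forall x : U, x ∈ Y <-> x ∈ k /\ x ∉ X.

(** [I] is the intersection of the (nonempty) family [A] *)
Definition inter A I := forall x, x ∈ I <-> forall X, X ∈ A -> x ∈ X.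

Definition ultrafilter k W :=
  (forall X, X ∈ W -> subset X k) /\
  k ∈ W /\
  (forall X, X ∈ W -> ~ empty X) /\
  (forall X Y, X ∈ W -> subset X Y -> subset Y k -> Y ∈ W) /\
  (forall X Y Z, X ∈ W -> Y ∈ W -> inter2 X Y Z -> Z ∈ W) /\
  (forall X Y, subset X k -> complement k X Y -> X ∈ W \/ Y ∈ W).

(** [|A| < k], for a cardinal [k] *)
Definition card_lt A k := exists a f, a ∈ k /\ bijection f a A.

(** [W] is closed under intersections of fewer than [k] members *)
Definition complete k W :=
  forall A I, subset A W -> nonempty A -> card_lt A k -> inter A I -> I ∈ W.

(** de Bruijn indices: [f_all] binds variable 0 *)
Inductive formula :=
| f_mem (i j : nat)
| f_eq (i j : nat)
| f_false
| f_imp (phi psi : formula)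
| f_all (phi : formula).

Definition scons x (e : nat -> U) (n : nat) : U :=
  match n with 0 => x | S n => e n end.

Fixpoint sat (e : nat -> U) (phi : formula) : Prop :=
  match phi with
  | f_mem i j => e i ∈ e j
  | f_eq i j => e i = e j
  | f_false => False
  | f_imp phi psi => sat e phi -> sat e psi
  | f_all phi => forall x, sat (scons x e) phi
  end.

Record ZFC : Prop := {
  extensionality : forall x y, (forall z, z ∈ x <-> z ∈ y) -> x = y;
  foundation : forall x, nonempty x ->
    exists y, y ∈ x /\ forall z, z ∈ x -> z ∉ y;
  pairing : forall a b, exists p, upair a b p;
  union : forall x, exists u, forall z, z ∈ u <-> exists y, y ∈ x /\ z ∈ y;
  power : forall x, exists u, forall z, z ∈ u <-> subset z x;
  infinity : exists w,
    (exists x, empty x /\ x ∈ w) /\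
    (forall x, x ∈ w -> exists y, succ x y /\ y ∈ w);
  separation : forall (phi : formula) (e : nat -> U) x,
    exists u, forall z, z ∈ u <-> z ∈ x /\ sat (scons z e) phi;
  replacement : forall (phi : formula) (e : nat -> U),
    (forall x y y', sat (scons x (scons y e)) phi ->
                    sat (scons x (scons y' e)) phi -> y = y') ->
    forall a, exists b, forall y,
      y ∈ b <-> exists x, x ∈ a /\ sat (scons x (scons y e)) phi;
  choice : forall x, (forall y, y ∈ x -> nonempty y) ->
    exists f, function_on f x /\ forall y z, app f y z -> z ∈ y
}.

(** Below, [w] is [ω], [g] is the sequence [⟨γ_n : n < ω⟩], [D] the function of
    ultrafilters, and [c] the supremum of [g]. *)

Definition cardinal_sequence w g c :=
  function_on g w /\
  (forall n x, app g n x -> infinite_cardinal w x) /\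
  increasing g /\
  supremum g c.

(** [(n, a)] is [(0, 0)], or [0 < n < ω] and [a < γ_{n-1}] *)
Definition index w g n a :=
  (empty n /\ empty a) \/
  (n ∈ w /\ exists m x, succ m n /\ app g m x /\ a ∈ x).

Definition ultrafilter_system w g D :=
  function D /\
  (forall p, (exists W, app D p W) <-> exists n a, index w g n a /\ pair n a p) /\
  (forall n a x W, app2 D n a W -> app g n x -> ultrafilter x W /\ complete x W) /\
  (forall n a b W, app2 D n a W -> app2 D n b W -> a = b).

Definition choice_function D F :=
  function F /\
  (forall p, (exists X, app F p X) <-> (exists W, app D p W)) /\
  (forall p X W, app F p X -> app D p W -> X ∈ W).

(** [p = (s, F)] is a condition *)
Definition condition w g D p :=
  exists s F, pair s F p /\
    (exists k, k ∈ w /\ nonempty k /\ function_on s k) /\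
    increasing s /\
    (forall i a x, app s i a -> app g i x -> a ∈ x) /\
    choice_function D F.

(** [s(i) ∈ F(i, s(i-1))] *)
Definition follows F s i :=
  exists j a b X, succ j i /\ app s j a /\ app s i b /\ app2 F i a X /\ b ∈ X.

(** [q = (s', F')] is stronger than [p = (s, F)] *)
Definition stronger q p :=
  exists s' F' s F k' k,
    pair s' F' q /\ pair s F p /\ dom s' k' /\ dom s k /\
    le k k' /\
    (forall i a, i ∈ k -> (app s' i a <-> app s i a)) /\
    (forall x X' X, app F' x X' -> app F x X -> subset X' X) /\
    (forall i, i ∈ k' -> i ∉ k -> follows F s' i).

Definition dense w g D A :=
  (forall q, q ∈ A -> condition w g D q) /\
  (forall p, condition w g D p -> exists q, q ∈ A /\ stronger q p).

End Notions.

(** The universe of sets: well-founded trees modulo bisimilarity.  An element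
    of [V] is a bisimilarity class, so that equality of sets is [=]. *)

Inductive tree := sup (A : Type) (f : A -> tree).

Fixpoint bisim (s t : tree) : Prop :=
  match s, t with
  | sup f, sup h =>
      (forall a, exists b, bisim (f a) (h b)) /\
      (forall b, exists a, bisim (f a) (h b))
  end.

Definition child (s t : tree) : Prop :=
  match t with sup h => exists b, bisim s (h b) end.

Definition V : structure := {|
  carrier := {c : tree -> Prop | exists t, c = bisim t};
  mem x y := exists s t, proj1_sig x s /\ proj1_sig y t /\ child s t
|}.

(** [M] may be a set or a proper class. *)
Definition transitive_class (M : V -> Prop) :=
  forall x y : V, M y -> x ∈ y -> M x.

Definition inner (M : V -> Prop) : structure := {|
  carrier := {x : V | M x};
  mem x y := proj1_sig x ∈ proj1_sig y
|}.

Definition val (M : V -> Prop) (x : inner M) : V := proj1_sig x.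

(** Genericity.  The forcing, its order and the dense sets are those of [M];
    the filter [G] is a set of [V]. *)

Section Generic.
Variables (M : V -> Prop) (w g D : inner M).

Definition generic (G : V) :=
  (forall x, x ∈ G -> exists p : inner M, val p = x /\ condition w g D p) /\
  (exists p : inner M, val p ∈ G) /\
  (forall p q : inner M, condition w g D p -> val q ∈ G -> stronger q p ->
     val p ∈ G) /\
  (forall p q : inner M, val p ∈ G -> val q ∈ G ->
     exists r : inner M, val r ∈ G /\ stronger r p /\ stronger r q) /\
  (forall A : inner M, dense w g D A -> exists p : inner M, p ∈ A /\ val p ∈ G).

(** [S = ⋃ {s : ∃ F, (s, F) ∈ G}] for some generic [G] *)
Definition generic_sequence (S : V) :=
  exists G : V, generic G /\
    forall x, x ∈ S <-> exists s F p : V, pair s F p /\ p ∈ G /\ x ∈ s.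

End Generic.

(* Main.v *)
(** Countable completeness and diagonal intersections replace a Prikry property.
    Given a generic filter, the conditions whose choice function refines a given
    [F] are dense, so the generic sequence eventually follows [F].  Conversely,
    let [S] eventually follow every choice function in [M], and let
    [G = {(s, F) : s ⊂ S, S follows F from |s| on}].  The point is that [G] meets
    each dense [A ∈ M].  Call a finite sequence [t] secured if some [F] and [m]
    are such that each extension of [t] that follows [F] and is longer than [m]
    is compatible, together with [F], with a member of [A].  If almost all
    one-step extensions of [t] are secured, so is [t], as the bounds [m] can be
    made equal on a set in the ultrafilter.  Hence an unsecured [t] would have a
    choice function that only leads to unsecured sequences, against the density
    of [A]; so every [t] is secured, by some [F_t].  The diagonal intersection of
    the [F_t] is followed by [S] from some [n] on; then [F_t] with [t = S|n] gives
    a member of [A] that lies in [G]. *)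

(* The obstacle is that [S] need not belong to [M], so no separation or choice inside [M] can
   mention it. All the work on a dense [A] is therefore done in [M], in terms of finite sequences,
   and ends in one choice function that depends on [A] alone. A branch from outside enters only
   through its finite restrictions, which do belong to [M], and through inductions justified by the
   well-foundedness of the outer universe.

   Countable completeness comes from $\omega\subseteq\gamma_0\in\gamma_i$ for $i>0$, which holds
   even if $\gamma_0=\omega$. Stems are nonempty, so these are the only coordinates at which a
   choice function is ever tested; this is the source of the many assumptions [nonempty k].

   Separation and replacement are schemes over formulas, so every set formed in [M] requires its
   defining property to be exhibited as definable with parameters. *)
From Stdlib Require Import Classical ProofIrrelevance PropExtensionality.
From Stdlib Require Import FunctionalExtensionality List Lia.
Require Import Defs.
Local Open Scope sets_scope.

(** * Definability *)

Section Definability.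
Variable U : structure.

Definition holds_at (l : list U) (c : nat) (e : nat -> U) : Prop :=
  forall i x, nth_error l i = Some x -> e (c + i) = x.

(** The list [l] collects the set constants of [P]; a formula for [P] finds them
    in the environment from any prescribed position [c] on. *)
Definition definable (P : (nat -> U) -> Prop) : Prop :=
  exists l, forall c, exists phi, forall e,
    holds_at l c e -> (sat e phi <-> P e).

(** With variables and constants only, a shift under a binder turns a term into a term of the same
    kind, and no substitution into formulas is needed. *)
Inductive term : ((nat -> U) -> U) -> Prop :=
| term_var n : term (fun e => e n)
| term_const (a : U) : term (fun _ => a).

Lemma holds_at_app l1 l2 c e :
  holds_at (l1 ++ l2) c e -> holds_at l1 c e /\ holds_at l2 (c + length l1) e.
Proof.
  intros H; split; intros i x Hi.
  - apply H. rewrite nth_error_app1; auto.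
    apply nth_error_Some; congruence.
  - replace (c + length l1 + i) with (c + (length l1 + i)) by lia.
    apply H. rewrite nth_error_app2 by lia.
    now replace (length l1 + i - length l1) with i by lia.
Qed.

Lemma term_index s : term s ->
  exists l, forall c, exists n, forall e, holds_at l c e -> e n = s e.
Proof.
  intros [n | a].
  - exists nil. intros c. now exists n.
  - exists (a :: nil). intros c. exists (c + 0). intros e He. now apply He.
Qed.

Lemma definable_mem s t : term s -> term t -> definable (fun e => s e ∈ t e).
Proof.
  intros Hs Ht. destruct (term_index _ Hs) as [l1 H1], (term_index _ Ht) as [l2 H2].
  exists (l1 ++ l2). intros c.
  destruct (H1 c) as [m Hm], (H2 (c + length l1)) as [n Hn].
  exists (f_mem m n). intros e He. apply holds_at_app in He as [He1 He2].
  simpl. now rewrite (Hm e He1), (Hn e He2).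
Qed.

Lemma definable_eq s t : term s -> term t -> definable (fun e => s e = t e).
Proof.
  intros Hs Ht. destruct (term_index _ Hs) as [l1 H1], (term_index _ Ht) as [l2 H2].
  exists (l1 ++ l2). intros c.
  destruct (H1 c) as [m Hm], (H2 (c + length l1)) as [n Hn].
  exists (f_eq m n). intros e He. apply holds_at_app in He as [He1 He2].
  simpl. now rewrite (Hm e He1), (Hn e He2).
Qed.

Lemma definable_False : definable (fun _ => False).
Proof. exists nil. intros c. now exists f_false. Qed.

Lemma definable_imp P Q :
  definable P -> definable Q -> definable (fun e => P e -> Q e).
Proof.
  intros [l1 H1] [l2 H2]. exists (l1 ++ l2). intros c.
  destruct (H1 c) as [phi Hphi], (H2 (c + length l1)) as [psi Hpsi].
  exists (f_imp phi psi). intros e He. apply holds_at_app in He as [He1 He2].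
  simpl. now rewrite (Hphi e He1), (Hpsi e He2).
Qed.

(** Under the binder the constants sit one position higher, so the formula for the body is taken at
    [S c]; this is one reason why [definable] allows every position. *)
Lemma definable_forall (Q : (nat -> U) -> U -> Prop) :
  definable (fun e => Q (fun n => e (S n)) (e 0)) ->
  definable (fun e => forall x, Q e x).
Proof.
  intros [l H]. exists l. intros c. destruct (H (S c)) as [phi Hphi].
  exists (f_all phi). intros e He. simpl.
  split; intros Hx x; specialize (Hx x); apply (Hphi (scons x e)); auto.
Qed.

Lemma definable_ext P Q :
  (forall e, P e <-> Q e) -> definable P -> definable Q.
Proof.
  intros H [l HP]. exists l. intros c. destruct (HP c) as [phi Hphi].
  exists phi. intros e He. rewrite <- H. auto.
Qed.

Lemma definable_not P : definable P -> definable (fun e => ~ P e).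
Proof. intros H. apply definable_imp; auto using definable_False. Qed.

Lemma definable_and P Q :
  definable P -> definable Q -> definable (fun e => P e /\ Q e).
Proof.
  intros HP HQ. apply definable_ext with (fun e => ~ (P e -> ~ Q e)).
  - intros e; tauto.
  - auto using definable_imp, definable_not.
Qed.

Lemma definable_or P Q :
  definable P -> definable Q -> definable (fun e => P e \/ Q e).
Proof.
  intros HP HQ. apply definable_ext with (fun e => ~ P e -> Q e).
  - intros e; tauto.
  - auto using definable_imp, definable_not.
Qed.

Lemma definable_iff P Q :
  definable P -> definable Q -> definable (fun e => P e <-> Q e).
Proof. intros HP HQ. apply definable_and; auto using definable_imp. Qed.

Lemma definable_exists (Q : (nat -> U) -> U -> Prop) :
  definable (fun e => Q (fun n => e (S n)) (e 0)) ->
  definable (fun e => exists x, Q e x).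
Proof.
  intros H. apply definable_ext with (fun e => ~ forall x, ~ Q e x).
  - intros e. split.
    + apply not_all_not_ex.
    + intros [x Hx] Hn. now apply (Hn x).
  - apply definable_not, definable_forall, definable_not, H.
Qed.

Definition definable1 (P : U -> Prop) := definable (fun e => P (e 0)).
Definition definable2 (R : U -> U -> Prop) := definable (fun e => R (e 0) (e 1)).

(** A fresh variable 0 is bound to the value of [s] by an equation, so the formula for [P] can be
    used as it stands. *)
Lemma definable1_term P s : definable1 P -> term s -> definable (fun e => P (s e)).
Proof.
  intros HP Hs. apply definable_ext with (fun e => forall x, x = s e -> P x).
  - intros e. split; [auto | intros H x ->; auto].
  - apply definable_forall, definable_imp; [|exact HP].
    destruct Hs; apply definable_eq; constructor.
Qed.

Lemma definable2_term R s t :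
  definable2 R -> term s -> term t -> definable (fun e => R (s e) (t e)).
Proof.
  intros HP Hs Ht.
  apply definable_ext with (fun e => forall y, y = t e -> forall x, x = s e -> R x y).
  - intros e. split; [auto | intros H y -> x ->; auto].
  - apply definable_forall, definable_imp.
    + destruct Ht; apply definable_eq; constructor.
    + apply definable_forall, definable_imp; [|exact HP].
      destruct Hs; apply definable_eq; constructor.
Qed.

End Definability.

Arguments term {U}.
Arguments definable {U}.
Arguments definable1 {U}.
Arguments definable2 {U}.

Create HintDb def discriminated.
Hint Constants Opaque : def.
Hint Resolve term_var term_const : def.
Hint Resolve definable_mem definable_eq definable_False definable_imp
  definable_forall definable_not definable_and definable_or definable_iff
  definable_exists definable1_term definable2_term : def.

(** Case analysis on the [term] hypotheses leaves literal variables and constants, which the hints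
    can still recognize after a shift. *)
Ltac def :=
  unfold definable1, definable2; intros;
  repeat match goal with H : term _ |- _ => destruct H end;
  auto 200 with def nocore.

(** * Definability of the notions of the theorem *)

Section DefinableNotions.
Variable U : structure.
Implicit Types s t u v r : (nat -> U) -> U.

Lemma definable_subset s t :
  term s -> term t -> definable (fun e => subset (s e) (t e)).
Proof. unfold subset. def. Qed.

Lemma definable_nonempty s : term s -> definable (fun e => nonempty (s e)).
Proof. unfold nonempty. def. Qed.

Lemma definable_succ s t :
  term s -> term t -> definable (fun e => succ (s e) (t e)).
Proof. unfold succ. def. Qed.

Lemma definable_pair s t u : term s -> term t -> term u ->
  definable (fun e => pair (s e) (t e) (u e)).
Proof. unfold pair, upair. def. Qed.
Hint Resolve definable_pair : def.

Lemma definable_app s t u : term s -> term t -> term u ->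
  definable (fun e => app (s e) (t e) (u e)).
Proof. unfold app. def. Qed.
Hint Resolve definable_app : def.

Lemma definable_app2 s t u v : term s -> term t -> term u -> term v ->
  definable (fun e => app2 (s e) (t e) (u e) (v e)).
Proof. unfold app2. def. Qed.

Lemma definable_function s : term s -> definable (fun e => function (s e)).
Proof. unfold function. def. Qed.

Lemma definable_dom s t : term s -> term t -> definable (fun e => dom (s e) (t e)).
Proof. unfold dom. def. Qed.
Hint Resolve definable_function definable_dom definable_app2 : def.

Lemma definable_function_on s t :
  term s -> term t -> definable (fun e => function_on (s e) (t e)).
Proof. unfold function_on. def. Qed.

Lemma definable_increasing s : term s -> definable (fun e => increasing (s e)).
Proof. unfold increasing. def. Qed.

Lemma definable_choice_function s t :
  term s -> term t -> definable (fun e => choice_function (s e) (t e)).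
Proof. unfold choice_function. def. Qed.
Hint Resolve definable_subset definable_succ : def.

Lemma definable_follows s t u : term s -> term t -> term u ->
  definable (fun e => follows (s e) (t e) (u e)).
Proof. unfold follows. def. Qed.

End DefinableNotions.

Hint Resolve definable_subset definable_nonempty definable_succ definable_pair
  definable_app definable_app2 definable_function definable_dom
  definable_function_on definable_increasing definable_choice_function
  definable_follows : def.

(** * Sets and ultrafilters in a well-founded model *)

(** Only extensionality is assumed, because the lemma is also applied to [V], for which [ZFC] is not
    established. *)
Lemma pair_unique_ext (U : structure) (a b p p' : U) :
  (forall x y : U, (forall z, z ∈ x <-> z ∈ y) -> x = y) ->
  pair a b p -> pair a b p' -> p = p'.
Proof.
  intros ext.
  assert (Hu : forall a b u u' : U, upair a b u -> upair a b u' -> u = u').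
  { intros c d u u' H H'. apply ext. intros z. rewrite (H z), (H' z). reflexivity. }
  intros (u & v & H1 & H2 & H3) (u' & v' & H1' & H2' & H3').
  rewrite (Hu _ _ _ _ H1' H1), (Hu _ _ _ _ H2' H2) in H3'. eauto.
Qed.

Section SetTheory.
Variable U : structure.
Hypothesis U_ZFC : ZFC U.
(** The model is well-founded from the outside: [P] need not be definable. *)
Hypothesis mem_ind : forall P : U -> Prop,
  (forall x, (forall y, y ∈ x -> P y) -> P x) -> forall x, P x.

Lemma definable_separation (P : U -> Prop) x :
  definable1 P -> exists u, forall z, z ∈ u <-> z ∈ x /\ P z.
Proof.
  (* Position 0 holds the element under test, so the constants start at 1; past their end the
     environment is padded with [x]. *)
  intros [l H]. destruct (H 1) as [phi Hphi].
  destruct (separation U_ZFC phi (fun n => nth n l x) x) as [u Hu].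
  exists u. intros z. rewrite Hu, Hphi; [reflexivity|].
  intros i a Hi. simpl. now apply nth_error_nth.
Qed.

Lemma definable_replacement (R : U -> U -> Prop) a :
  definable2 R -> (forall x y y', R x y -> R x y' -> y = y') ->
  exists b, forall y, y ∈ b <-> exists x, x ∈ a /\ R x y.
Proof.
  intros [l H] HR. destruct (H 2) as [phi Hphi].
  assert (He : forall x y, sat (scons x (scons y (fun n => nth n l a))) phi <-> R x y).
  { intros x y. rewrite Hphi; [reflexivity|].
    intros i c Hi. simpl. now apply nth_error_nth. }
  destruct (@replacement U U_ZFC phi (fun n => nth n l a)) with (a := a) as [b Hb].
  - intros x y y'. rewrite !He. apply HR.
  - exists b. intros y. rewrite Hb.
    split; intros [x [Hx Hxy]]; exists x; split; auto; now apply He.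
Qed.

Lemma mem_irrefl (x : U) : x ∉ x.
Proof.
  revert x. apply (mem_ind (fun x => x ∉ x)). intros x IH Hx. exact (IH x Hx Hx).
Qed.

(** The axiom of foundation gives this for sets of the model; here [P] may be any class, definable
    or not. Applied to a finite list of sets, it excludes cycles of membership. *)
Lemma mem_min (P : U -> Prop) x : P x -> exists y, P y /\ forall z, z ∈ y -> ~ P z.
Proof.
  apply NNPP. intros H.
  revert x H. apply (mem_ind (fun x => ~ ~ (P x -> _))).
  intros x IH H. apply H. intros Hx. exists x. split; auto.
  intros z Hz HPz. apply (IH z Hz). intros Hm. apply H. auto.
Qed.

Lemma mem_asym (x y : U) : x ∈ y -> y ∉ x.
Proof.
  intros H H'. destruct (mem_min (fun z => z = x \/ z = y) x) as (m & [-> | ->] & Hm); auto.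
  - apply (Hm y); auto.
  - apply (Hm x); auto.
Qed.

Lemma pair_ex (a b : U) : exists p, pair a b p.
Proof.
  destruct (pairing U_ZFC a a) as [u Hu], (pairing U_ZFC a b) as [v Hv].
  destruct (pairing U_ZFC u v) as [p Hp]. exists p, u, v. auto.
Qed.

Lemma pair_unique (a b p p' : U) : pair a b p -> pair a b p' -> p = p'.
Proof. apply pair_unique_ext, U_ZFC. Qed.

Lemma pair_inj (a b a' b' p : U) : pair a b p -> pair a' b' p -> a = a' /\ b = b'.
Proof.
  intros (u & v & Hu & Hv & Hp) (u' & v' & Hu' & Hv' & Hp').
  unfold upair in *.
  assert (a ∈ u) by (apply Hu; auto). assert (a ∈ v) by (apply Hv; auto).
  assert (b ∈ v) by (apply Hv; auto). assert (a' ∈ u') by (apply Hu'; auto).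
  assert (a' ∈ v') by (apply Hv'; auto). assert (b' ∈ v') by (apply Hv'; auto).
  assert (u ∈ p) as E1 by (apply Hp; auto). assert (v ∈ p) as E2 by (apply Hp; auto).
  assert (u' ∈ p) as E3 by (apply Hp'; auto). assert (v' ∈ p) as E4 by (apply Hp'; auto).
  apply Hp' in E1, E2. apply Hp in E3, E4.
  assert (a = a').
  { destruct E3; subst u'.
    - assert (a' = a \/ a' = a) by now apply Hu. intuition congruence.
    - assert (a = a' \/ a = a') by now apply Hu'. intuition congruence. }
  split; auto. subst a'.
  assert (Hb : b = a \/ b = b').
  { destruct E2; subst v.
    - left. assert (b = a \/ b = a) by now apply Hu'. tauto.
    - now apply Hv'. }
  assert (Hb' : b' = a \/ b' = b).
  { destruct E4; subst v'.
    - left. assert (b' = a \/ b' = a) by now apply Hu. tauto.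
    - now apply Hv. }
  intuition congruence.
Qed.

Lemma app_pair (f x y p : U) : pair x y p -> (p ∈ f <-> app f x y).
Proof.
  intros Hp. split.
  - intros H. now exists p.
  - intros (q & Hq & H). now rewrite (pair_unique _ _ _ _ Hp Hq).
Qed.

Lemma app2_pair (f x y p z : U) : pair x y p -> (app f p z <-> app2 f x y z).
Proof.
  intros Hp. split.
  - intros H. now exists p.
  - intros (q & Hq & H). now rewrite (pair_unique _ _ _ _ Hp Hq).
Qed.

Lemma function_ext (f f' : U) : function f -> function f' ->
  (forall x y, app f x y <-> app f' x y) -> f = f'.
Proof.
  intros [Hf _] [Hf' _] H. apply (extensionality U_ZFC). intros p. split; intros Hp.
  - destruct (Hf p Hp) as (x & y & Hxy).
    apply (app_pair _ _ _ _ Hxy), H, (app_pair _ _ _ _ Hxy), Hp.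
  - destruct (Hf' p Hp) as (x & y & Hxy).
    apply (app_pair _ _ _ _ Hxy), H, (app_pair _ _ _ _ Hxy), Hp.
Qed.

Lemma graph_ex (R : U -> U -> Prop) d :
  definable2 R -> (forall x y y', R x y -> R x y' -> y = y') ->
  exists f, function f /\ forall x y, app f x y <-> x ∈ d /\ R x y.
Proof.
  intros HR Hfun.
  destruct (definable_replacement (fun x p => exists y, R x y /\ pair x y p) d)
    as [f Hf].
  - def.
  - intros x p p' (y & Hy & Hp) (y' & Hy' & Hp').
    rewrite (Hfun _ _ _ Hy' Hy) in Hp'. eauto using pair_unique.
  - assert (Happ : forall x y, app f x y <-> x ∈ d /\ R x y).
    { intros x y. split.
      - intros (p & Hp & Hpf). apply Hf in Hpf as (x' & Hx' & y' & HR' & Hp').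
        destruct (pair_inj _ _ _ _ _ Hp Hp'); subst. auto.
      - intros [Hx Hxy]. destruct (pair_ex x y) as [p Hp]. exists p. split; auto.
        apply Hf. eauto. }
    exists f. split; auto. split.
    + intros p Hp. apply Hf in Hp as (x & _ & y & _ & Hp). eauto.
    + intros x y y' H H'. apply Happ in H, H'. destruct H, H'. eauto.
Qed.

Lemma union2_ex (a b : U) : exists u, forall z, z ∈ u <-> z ∈ a \/ z ∈ b.
Proof.
  destruct (pairing U_ZFC a b) as [p Hp], (union U_ZFC p) as [u Hu].
  exists u. intros z. rewrite Hu. split.
  - intros (y & Hy & Hz). apply Hp in Hy as [-> | ->]; auto.
  - intros [H | H]; [exists a | exists b]; split; auto; apply Hp; auto.
Qed.

Lemma adjoin_ex (a b : U) : exists u, forall z, z ∈ u <-> z ∈ a \/ z = b.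
Proof.
  destruct (pairing U_ZFC b b) as [p Hp], (union2_ex a p) as [u Hu].
  exists u. intros z. rewrite Hu, (Hp z). tauto.
Qed.

Lemma product_bound (a b : U) :
  exists c, forall x y p, x ∈ a -> y ∈ b -> pair x y p -> p ∈ c.
Proof.
  destruct (union2_ex a b) as [u Hu].
  destruct (power U_ZFC u) as [v Hv], (power U_ZFC v) as [c Hc].
  exists c. intros x y p Hx Hy (s & t & Hs & Ht & Hp).
  apply Hc. intros r Hr. apply Hv. intros z Hz. apply Hu.
  apply Hp in Hr as [-> | ->].
  - apply Hs in Hz as [-> | ->]; auto.
  - apply Ht in Hz as [-> | ->]; auto.
Qed.

Lemma succ_unique (x y y' : U) : succ x y -> succ x y' -> y = y'.
Proof.
  intros H H'. apply (extensionality U_ZFC). intros z. now rewrite (H z), (H' z).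
Qed.

Lemma succ_inj (x x' y : U) : succ x y -> succ x' y -> x = x'.
Proof.
  intros H H'.
  assert (Hx : x ∈ x' \/ x = x') by (apply H', H; auto).
  assert (Hx' : x' ∈ x \/ x' = x) by (apply H, H'; auto).
  destruct Hx as [Hx | Hx], Hx' as [Hx' | Hx']; auto.
  exfalso. exact (mem_asym x x' Hx Hx').
Qed.

(** ** Ultrafilters *)

Section Ultrafilter.
Variables k W : U.
Hypothesis k_transitive : transitive k.
Hypothesis W_ultrafilter : ultrafilter k W.
Hypothesis W_complete : complete k W.

Lemma ultrafilter_inhabited X : X ∈ W -> exists z, z ∈ X.
Proof.
  intros HX. destruct W_ultrafilter as (_ & _ & Hne & _).
  apply NNPP. intros H. apply (Hne X HX). intros z Hz. eauto.
Qed.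

Lemma ultrafilter_inter2 X Y : X ∈ W -> Y ∈ W ->
  exists Z, Z ∈ W /\ forall z, z ∈ Z -> z ∈ X /\ z ∈ Y.
Proof.
  intros HX HY. destruct W_ultrafilter as (_ & _ & _ & _ & Hi & _).
  destruct (definable_separation (fun z => z ∈ Y) X) as [Z HZ]; [def|].
  exists Z. split; [apply (Hi X Y); auto | apply HZ].
Qed.

(** Brings membership into the form that [complete_injective_family] asks for: the whole extent of
    [P] in [k], not just some part of it. *)
Lemma ultrafilter_extent (P : U -> Prop) X :
  definable1 P -> X ∈ W -> (forall z, z ∈ X -> P z) ->
  exists Y, Y ∈ W /\ forall z, z ∈ Y <-> z ∈ k /\ P z.
Proof.
  intros HP HX HXP. destruct W_ultrafilter as (Hs & _ & _ & Hup & _).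
  destruct (definable_separation P k HP) as [Y HY].
  exists Y. split; auto. apply (Hup X); auto.
  - intros z Hz. apply HY. split; auto. now apply (Hs X).
  - intros z Hz. now apply HY.
Qed.

Lemma ultrafilter_em (P : U -> Prop) : definable1 P ->
  (exists X, X ∈ W /\ forall z, z ∈ X -> z ∈ k /\ P z) \/
  (exists X, X ∈ W /\ forall z, z ∈ X -> z ∈ k /\ ~ P z).
Proof.
  intros HP. destruct W_ultrafilter as (_ & _ & _ & _ & _ & Hem).
  destruct (definable_separation P k HP) as [X HX].
  destruct (definable_separation (fun z => z ∉ X) k) as [Y HY]; [def|].
  destruct (Hem X Y) as [H | H].
  - intros z Hz. now apply HX.
  - intros z. apply HY.
  - left. exists X. split; auto. apply HX.
  - right. exists Y. split; auto. intros z Hz. apply HY in Hz as [Hz HzX].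
    split; auto. intros Hz'. apply HzX, HX. auto.
Qed.

(** [card_lt] asks for a bijection from an element of [k] onto the family. With injective indexing,
    sending [b] to its set is such a bijection; otherwise repetitions would have to be removed
    first. *)
Lemma complete_injective_family (Y : U -> U -> Prop) a :
  definable2 Y -> a ∈ k -> nonempty a ->
  (forall b, b ∈ a -> exists X, X ∈ W /\ forall z, z ∈ X <-> z ∈ k /\ Y b z) ->
  (forall b b', b ∈ a -> b' ∈ a ->
     (forall z, z ∈ k -> (Y b z <-> Y b' z)) -> b = b') ->
  exists I, I ∈ W /\ forall z b, z ∈ I -> b ∈ a -> Y b z.
Proof.
  intros HY Ha [b0 Hb0] HW Hinj.
  set (R := fun b X => forall z, z ∈ X <-> z ∈ k /\ Y b z).
  assert (HR : definable2 R) by (unfold R; def).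
  assert (Hfun : forall b X X', R b X -> R b X' -> X = X').
  { intros b X X' H H'. apply (extensionality U_ZFC). intros z. now rewrite (H z), (H' z). }
  destruct (definable_replacement R a HR Hfun) as [A HA].
  destruct (graph_ex R a HR Hfun) as (f & Hf & Happ).
  assert (Hne : nonempty A).
  { destruct (HW b0 Hb0) as (X & _ & HX). exists X. apply HA. exists b0. auto. }
  assert (HAW : subset A W).
  { intros X HX. apply HA in HX as (b & Hb & HX).
    destruct (HW b Hb) as (X' & HX' & HR'). now rewrite (Hfun b X X'). }
  destruct (definable_separation (fun z => forall X, X ∈ A -> z ∈ X) k) as [I HI]; [def|].
  exists I. split.
  - apply (W_complete A I); auto.
    + exists a, f. split; auto. split; [|split].
      * split; [split|]; auto.
        -- intros b. split.
           ++ intros Hb. destruct (HW b Hb) as (X & _ & HX). exists X. now apply Happ.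
           ++ intros [X HX]. now apply Happ in HX.
        -- intros b X HX. apply Happ in HX. apply HA. eauto.
      * intros b b' X HX HX'. apply Happ in HX as [Hb HX], HX' as [Hb' HX'].
        apply Hinj; auto. intros z Hz. specialize (HX z). specialize (HX' z). tauto.
      * intros X HX. apply HA in HX as (b & Hb & HX). exists b. now apply Happ.
    + intros z. split.
      * intros Hz. now apply HI.
      * intros Hz. apply HI. split; auto. destruct Hne as [X HX].
        destruct W_ultrafilter as (Hs & _). apply (Hs X); auto.
  - intros z b Hz Hb. apply HI in Hz as [Hz HzA].
    destruct (HW b Hb) as (X & _ & HX). apply HX, HzA, HA. eauto.
Qed.

(** Completeness is stated for families indexed injectively.  In the
    nonprincipal case [a] itself is null, so an arbitrary family [X b] can be
    replaced by the injective family [X b \ a ∪ {b}]. *)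
Lemma complete_family (P : U -> U -> Prop) a :
  definable2 P -> a ∈ k ->
  (forall b, b ∈ a -> exists X, X ∈ W /\ forall z, z ∈ X -> P b z) ->
  exists X, X ∈ W /\ forall z b, z ∈ X -> b ∈ a -> P b z.
Proof.
  intros HP Ha HW.
  destruct (classic (nonempty a)) as [Hne | Hemp].
  2: { destruct W_ultrafilter as (_ & Hk & _). exists k. split; auto.
       intros z b _ Hb. exfalso. apply Hemp. now exists b. }
  (* Principal case: each member of [W] meets [X], so it contains the only point of [X], and [X]
     itself serves. *)
  destruct (classic (exists e X, X ∈ W /\ forall z, z ∈ X -> z = e))
    as [(e & X & HX & He) | Hnp].
  { exists X. split; auto. intros z b Hz Hb.
    destruct (HW b Hb) as (Y & HY & HYP).
    destruct (ultrafilter_inter2 X Y HX HY) as (Z & HZ & HZXY).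
    destruct (ultrafilter_inhabited Z HZ) as [y Hy].
    apply HZXY in Hy as [HyX HyY]. apply He in HyX, Hz. subst. auto. }
  assert (Hak : subset a k) by (apply k_transitive; auto).
  (* No singleton is in [W], so the complements of the points of [a] are. They are pairwise
     distinct, hence injectively indexed. *)
  assert (Hnull : exists I, I ∈ W /\ forall z b, z ∈ I -> b ∈ a -> z <> b).
  { apply (complete_injective_family (fun b z => z <> b) a); auto.
    - def.
    - intros b Hb. destruct (ultrafilter_em (fun z => z <> b)) as [(X & HX & Hz) | (X & HX & Hz)].
      + def.
      + apply (ultrafilter_extent _ X); [def | auto | apply Hz].
      + exfalso. apply Hnp. exists b, X. split; auto. intros z HzX.
        apply NNPP. now apply Hz.
    - intros b b' Hb Hb' H. apply NNPP. intros Hn. apply (H b); auto. }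
  destruct Hnull as (I1 & HI1 & Hdisj).
  destruct (complete_injective_family (fun b z => (P b z /\ z ∉ a) \/ z = b) a)
    as (I & HI & HIP); auto.
  - def.
  - intros b Hb. destruct (HW b Hb) as (X & HX & HXP).
    destruct (ultrafilter_inter2 X I1 HX HI1) as (Z & HZ & HZX).
    apply (ultrafilter_extent _ Z); [def | auto |].
    intros z Hz. apply HZX in Hz as [Hz Hz1]. left. split; auto.
    intros Hza. now apply (Hdisj z z).
  (* The point [b] lies in its own set; since [b ∈ a], it can lie in the set of [b'] only if
     [b = b']. *)
  - intros b b' Hb Hb' H. destruct (proj1 (H b (Hak b Hb))) as [[_ Hn] | ]; auto.
    contradiction.
  - destruct (ultrafilter_inter2 I I1 HI HI1) as (Z & HZ & HZI).
    exists Z. split; auto. intros z b Hz Hb. apply HZI in Hz as [Hz Hz1].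
    destruct (HIP z b Hz Hb) as [[H _] | H]; auto.
    now apply Hdisj with (b := b) in Hz1.
Qed.

End Ultrafilter.

(** * Choice functions and finite sequences *)

Section System.
Variables w g c D : U.
Hypothesis w_omega : is_omega w.
Hypothesis g_cardinals : cardinal_sequence w g c.
Hypothesis D_ultrafilters : ultrafilter_system w g D.

(** * The natural numbers of the model and the cardinals $\gamma_n$ *)

Lemma omega_transitive : transitive w.
Proof. apply w_omega. Qed.

Lemma omega_linear m n : m ∈ w -> n ∈ w -> m ∈ n \/ m = n \/ n ∈ m.
Proof. apply w_omega. Qed.

Lemma omega_elem_transitive n : n ∈ w -> transitive n.
Proof.
  intros Hn j Hj k Hk.
  assert (Hjw : j ∈ w) by (apply (omega_transitive n); auto).
  assert (Hkw : k ∈ w) by (apply (omega_transitive j); auto).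
  destruct (omega_linear k n Hkw Hn) as [H | [-> | H]]; auto; exfalso.
  - apply (mem_asym n j); auto.
  (* The cycle [k ∈ j ∈ n ∈ k] would have no minimal member. *)
  - destruct (mem_min (fun z => z = j \/ z = k \/ z = n) j)
      as (m & [-> | [-> | ->]] & Hm); auto.
    + apply (Hm k); auto.
    + apply (Hm n); auto.
    + apply (Hm j); auto.
Qed.

Lemma omega_zero : exists z, z ∈ w /\ empty z.
Proof.
  assert (Hne : nonempty w) by apply w_omega.
  destruct Hne as [x Hx]. destruct (mem_min (fun z => z ∈ w) x Hx) as (z & Hz & Hm).
  exists z. split; auto. intros y Hy. apply (Hm y Hy), (omega_transitive z); auto.
Qed.

(** Without a largest element [n] would be a limit ordinal, which [is_omega] forbids; the largest
    element is the predecessor. *)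
Lemma omega_pred n : n ∈ w -> nonempty n -> exists m, m ∈ w /\ succ m n.
Proof.
  intros Hn Hne.
  assert (Hord : ordinal n).
  { split; [now apply omega_elem_transitive | split].
    - intros y z Hy Hz. apply omega_linear; apply (omega_transitive n); auto.
    - intros u _ [x Hx]. destruct (mem_min (fun z => z ∈ u) x Hx) as (y & Hy & Hm).
      exists y. split; auto. intros z Hz Hzy. now apply (Hm z). }
  destruct (classic (exists y, y ∈ n /\ forall z, z ∈ n -> y ∉ z)) as [(y & Hy & Hmax) | H].
  - exists y. split; [apply (omega_transitive n); auto|]. intros z. split.
    + intros Hz.
      assert (Hyz : y ∈ z \/ y = z \/ z ∈ y) by now apply Hord.
      destruct Hyz as [Hyz | [-> | Hyz]]; auto. exfalso. now apply (Hmax z).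
    + intros [Hz | ->]; auto. apply (omega_elem_transitive n Hn y); auto.
  - exfalso. destruct w_omega as [_ Hl]. apply (Hl n Hn). split; [|split]; auto.
    intros y Hy. apply NNPP. intros Hno. apply H. exists y. split; auto.
    intros z Hz Hyz. apply Hno. eauto.
Qed.

(** A minimal element of ω above [n] has a predecessor, and minimality forces this predecessor to be
    [n]. *)
Lemma omega_succ n : n ∈ w -> exists m, m ∈ w /\ succ n m.
Proof.
  intros Hn.
  assert (Hz : exists z, z ∈ w /\ n ∈ z) by now apply w_omega.
  destruct Hz as [z Hz].
  destruct (mem_min (fun z => z ∈ w /\ n ∈ z) z Hz) as (m & [Hmw Hnm] & Hmin).
  destruct (omega_pred m Hmw) as (y & Hy & Hs); [now exists n|].
  apply Hs in Hnm as [Hny | ->]; [|now exists m].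
  exfalso. apply (Hmin y); auto. apply Hs. auto.
Qed.

(** It rests on [mem_ind], so [P] need not be definable: it may quantify over relations or mention a
    branch outside the model. *)
Lemma omega_induction (P : U -> Prop) :
  (forall n, n ∈ w -> empty n -> P n) ->
  (forall n m, n ∈ w -> m ∈ w -> succ n m -> P n -> P m) ->
  forall n, n ∈ w -> P n.
Proof.
  intros H0 HS. apply (mem_ind (fun n => n ∈ w -> P n)). intros n IH Hn.
  destruct (classic (nonempty n)) as [Hne | Hemp].
  - destruct (omega_pred n Hn Hne) as (m & Hm & Hs).
    apply (HS m n); auto. apply IH; auto. apply Hs. auto.
  - apply H0; auto. intros z Hz. apply Hemp. now exists z.
Qed.

Lemma omega_not_mem i k : i ∈ w -> k ∈ w -> i ∉ k -> k ∈ i \/ k = i.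
Proof. intros Hi Hk H. destruct (omega_linear i k Hi Hk) as [? | [? | ?]]; auto. contradiction. Qed.

Lemma gamma_ex n : n ∈ w -> exists x, app g n x.
Proof. intros Hn. now apply g_cardinals. Qed.

Lemma gamma_transitive n x : app g n x -> transitive x.
Proof. intros H. destruct g_cardinals as (_ & Hc & _). apply (Hc n x H). Qed.

Lemma gamma_omega n x : app g n x -> subset w x.
Proof. intros H. destruct g_cardinals as (_ & Hc & _). apply (Hc n x H). Qed.

Lemma gamma_index n x : app g n x -> n ∈ w.
Proof. intros H. apply g_cardinals. now exists x. Qed.

Lemma gamma_unique n x y : app g n x -> app g n y -> x = y.
Proof. apply g_cardinals. Qed.

Lemma system_ultrafilter p W : app D p W ->
  exists n a x, n ∈ w /\ pair n a p /\ app g n x /\ ultrafilter x W /\ complete x W.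
Proof.
  intros H. destruct D_ultrafilters as (_ & Hd & Hu & _).
  destruct (proj1 (Hd p)) as (n & a & Hi & Hp); [now exists W|].
  assert (Hn : n ∈ w).
  { destruct Hi as [[Hn _] | [Hn _]]; auto.
    destruct omega_zero as (z & Hz & Hez). replace n with z; auto.
    apply (extensionality U_ZFC). intros y. split; intros Hy.
    - now apply Hez in Hy.
    - now apply Hn in Hy. }
  destruct (gamma_ex n Hn) as [x Hx].
  exists n, a, x. split; auto. split; auto. split; auto.
  apply (Hu n a x W); auto. now exists p.
Qed.

Lemma system_app2 k j a x : k ∈ w -> succ j k -> app g j x -> a ∈ x ->
  exists p y W, pair k a p /\ app D p W /\ app g k y /\ ultrafilter y W /\ complete y W.
Proof.
  intros Hk Hj Hx Ha. destruct (pair_ex k a) as [p Hp].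
  destruct D_ultrafilters as (_ & Hd & Hu & _).
  destruct (proj2 (Hd p)) as [W HW].
  { exists k, a. split; auto. right. split; auto. exists j, x. auto. }
  destruct (gamma_ex k Hk) as [y Hy].
  exists p, y, W. split; auto. split; auto. split; auto.
  apply (Hu k a y W); auto. now exists p.
Qed.

(** * Choice functions and their diagonal intersections *)

Lemma choice_function_app F p W : choice_function D F -> app D p W ->
  exists X, app F p X /\ X ∈ W.
Proof.
  intros (_ & Hd & Hm) HW. destruct (proj2 (Hd p)) as [X HX]; [now exists W|].
  exists X. split; auto. now apply (Hm p).
Qed.

Lemma choice_function_dom F E p X : choice_function D F -> choice_function D E ->
  app F p X -> exists Y, app E p Y.
Proof. intros (_ & Hd & _) (_ & Hd' & _) H. apply Hd', Hd. now exists X. Qed.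

Lemma choice_function_unique F p X Y : choice_function D F ->
  app F p X -> app F p Y -> X = Y.
Proof. intros [[_ H] _]. apply H. Qed.

Lemma app_mem_union2 (f : U) : exists u, forall x y, app f x y -> x ∈ u /\ y ∈ u.
Proof.
  destruct (union U_ZFC f) as [v Hv], (union U_ZFC v) as [u Hu].
  exists u. intros x y (p & (s & t & _ & Ht & Hp) & Hpf).
  assert (t ∈ v) by (apply Hv; exists p; split; auto; apply Hp; auto).
  split; apply Hu; exists t; split; auto; apply Ht; auto.
Qed.

(** [F(p)] is the full extent of the property, so nothing has to be chosen. The union of [W] stands
    for $\gamma_n$, which is thus recovered from [W] without decoding [p]. *)
Lemma choice_function_extent (P : U -> U -> Prop) : definable2 P ->
  (forall p W, app D p W -> exists X, X ∈ W /\ forall z, z ∈ X -> P p z) ->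
  exists F, choice_function D F /\ forall p X W, app F p X -> app D p W ->
    forall z, z ∈ X <-> (exists Y, Y ∈ W /\ z ∈ Y) /\ P p z.
Proof.
  intros HP H. destruct (app_mem_union2 D) as [u Hu].
  set (R := fun p X => exists W, app D p W /\
              forall z, z ∈ X <-> (exists Y, Y ∈ W /\ z ∈ Y) /\ P p z).
  assert (HR : definable2 R) by (unfold R; def).
  assert (DF : forall p W W', app D p W -> app D p W' -> W = W') by apply D_ultrafilters.
  assert (Hfun : forall p X X', R p X -> R p X' -> X = X').
  { intros p X X' (W & HW & HX) (W' & HW' & HX').
    rewrite (DF _ _ _ HW' HW) in HX'. apply (extensionality U_ZFC).
    intros z. now rewrite HX, HX'. }
  destruct (graph_ex R u HR Hfun) as (F & HF & Happ).
  exists F. split; [split; [auto | split] |].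
  - intros p. split.
    + intros [X HX]. apply Happ in HX as (_ & W & HW & _). eauto.
    + intros [W HW]. destruct (union U_ZFC W) as [v Hv].
      destruct (definable_separation (fun z => P p z) v) as [X HX]; [def|].
      exists X. apply Happ. split; [now apply (Hu p W)|]. exists W. split; auto.
      intros z. now rewrite HX, Hv.
  - intros p X W HX HW. apply Happ in HX as (_ & W' & HW' & HX).
    rewrite (DF _ _ _ HW' HW) in HX. clear W' HW'.
    destruct (system_ultrafilter p W HW) as (n & a & k & _ & _ & _ & Huf & _).
    destruct (H p W HW) as (X0 & HX0 & HP0).
    destruct Huf as (Hs & Hk & _ & Hup & _).
    apply (Hup X0); auto.
    + intros z Hz. apply HX. split; auto. exists X0. auto.
    + intros z Hz. apply HX in Hz as [(Y & HY & Hz) _]. now apply (Hs Y).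
  - intros p X W HX HW. apply Happ in HX as (_ & W' & HW' & HX).
    now rewrite (DF _ _ _ HW' HW) in HX.
Qed.

Lemma choice_function_build (P : U -> U -> Prop) : definable2 P ->
  (forall p W, app D p W -> exists X, X ∈ W /\ forall z, z ∈ X -> P p z) ->
  exists F, choice_function D F /\ forall p X z, app F p X -> z ∈ X -> P p z.
Proof.
  intros HP H. destruct (choice_function_extent P HP H) as (F & HF & HFP).
  exists F. split; auto. intros p X z HX Hz.
  destruct (proj1 (proj1 (proj2 HF) p)) as [W HW]; [now exists X|].
  now apply (HFP p X W HX HW).
Qed.

Lemma choice_function_ex : exists F, choice_function D F.
Proof.
  destruct (choice_function_build (fun p z => p = p)) as (F & HF & _).
  - def.
  - intros p W HW. destruct (system_ultrafilter p W HW) as (n & a & k & _ & _ & _ & Huf & _).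
    exists k. split; [apply Huf | auto].
  - now exists F.
Qed.

Lemma choice_function_inter2 F E : choice_function D F -> choice_function D E ->
  exists H, choice_function D H /\ forall p X Y Z,
    app H p X -> app F p Y -> app E p Z -> inter2 Y Z X.
Proof.
  intros HF HE.
  destruct (choice_function_extent
    (fun p z => (forall Y, app F p Y -> z ∈ Y) /\ (forall Z, app E p Z -> z ∈ Z)))
    as (H & HH & HP).
  - def.
  - intros p W HW.
    destruct (system_ultrafilter p W HW) as (n & a & k & _ & _ & _ & Huf & _).
    destruct (choice_function_app F p W HF HW) as (Y & HY & HYW).
    destruct (choice_function_app E p W HE HW) as (Z & HZ & HZW).
    destruct (ultrafilter_inter2 k W Huf Y Z HYW HZW) as (X & HX & HXYZ).
    exists X. split; auto. intros z Hz. apply HXYZ in Hz as [Hz1 Hz2]. split.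
    + intros Y' HY'. now rewrite (choice_function_unique F p Y' Y).
    + intros Z' HZ'. now rewrite (choice_function_unique E p Z' Z).
  - exists H. split; auto. intros p X Y Z HX HY HZ z.
    destruct (proj1 (proj1 (proj2 HF) p)) as [W HW]; [now exists Y|].
    assert (HYW : Y ∈ W) by now apply (proj2 (proj2 HF) p).
    rewrite (HP p X W HX HW). split.
    + intros [_ [H1 H2]]. auto.
    + intros [H1 H2]. split; [eauto|]. split.
      * intros Y' HY'. now rewrite (choice_function_unique F p Y' Y).
      * intros Z' HZ'. now rewrite (choice_function_unique E p Z' Z).
Qed.

(** Makes families of choice functions into sets, so that the axiom of choice can select from
    them. *)
Lemma choice_functions_set : exists C, forall F, F ∈ C <-> choice_function D F.
Proof.
  destruct (app_mem_union2 D) as [u Hu], (union U_ZFC u) as [v Hv].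
  destruct (product_bound u v) as [b Hb], (power U_ZFC b) as [B HB].
  destruct (definable_separation (fun F => choice_function D F) B) as [C HC]; [def|].
  exists C. intros F. rewrite HC. split; [tauto|]. intros HF. split; auto.
  apply HB. intros q Hq. destruct HF as ([HFp _] & Hd & Hm).
  destruct (HFp q Hq) as (p & X & Hpair).
  assert (HX : app F p X) by now exists q.
  destruct (proj1 (Hd p)) as [W HW]; [now exists X|].
  apply (Hb p X); auto.
  - now apply (Hu p W).
  - apply Hv. exists W. split; [now apply (Hu p W) | now apply (Hm p)].
Qed.

(** [F(i, a) ⊆ E(i, a)] for [m <= i < ω] *)
Definition refines (m F E : U) : Prop :=
  forall i a X Y, i ∉ m -> app2 F i a X -> app2 E i a Y -> subset X Y.

Lemma definable_refines s t u : term s -> term t -> term u ->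
  definable (fun e => refines (s e) (t e) (u e)).
Proof. unfold refines. def. Qed.
Hint Resolve definable_refines : def.

Lemma refines_trans m E F H : choice_function D E -> choice_function D F ->
  refines m E F -> refines m F H -> refines m E H.
Proof.
  intros HE HF H1 H2 i a X Y Hi (p & Hp & HX) HY z Hz.
  destruct (choice_function_dom E F p X HE HF HX) as [Z HZ].
  apply (H2 i a Z Y); auto; [now exists p|].
  apply (H1 i a X Z); auto; now exists p.
Qed.

Lemma refines_mono m n E F : subset m n -> refines m E F -> refines n E F.
Proof. intros Hmn H i a X Y Hi. apply H. auto. Qed.

(** Choose a function for each [b ∈ a] and intersect coordinatewise. From [m] on the ultrafilters
    are closed under intersections indexed by [a]; below [m] nothing is required, and [refines m]
    does not look there. *)
Lemma choice_function_diagonal (R : U -> U -> Prop) a m : definable2 R ->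
  (forall i x, i ∉ m -> app g i x -> a ∈ x) ->
  (forall b, b ∈ a -> exists F, choice_function D F /\ R b F) ->
  exists E, choice_function D E /\ forall b, b ∈ a ->
    exists F, choice_function D F /\ R b F /\ refines m E F.
Proof.
  intros HR Ha HF. destruct choice_functions_set as [C HC].
  (* The axiom of choice selects from the members of a family of sets, so the function for [b] is
     chosen through the set [Q b] of all candidates. *)
  set (Q := fun b Y => forall F, F ∈ Y <-> F ∈ C /\ R b F).
  assert (HQ : definable2 Q) by (unfold Q; def).
  assert (Qfun : forall b Y Y', Q b Y -> Q b Y' -> Y = Y').
  { intros b Y Y' H H'. apply (extensionality U_ZFC). intros z. now rewrite (H z), (H' z). }
  assert (Qex : forall b, exists Y, Q b Y).
  { intros b. apply (definable_separation (fun F => R b F)). def. }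
  destruct (definable_replacement Q a HQ Qfun) as [A HA].
  destruct (@choice _ U_ZFC A) as (f & [[_ fU] fd] & fm).
  { intros Y HY. apply HA in HY as (b & Hb & HY).
    destruct (HF b Hb) as (F & HF1 & HF2). exists F. apply HY. split; auto. now apply HC. }
  set (phi := fun b F => exists Y, Q b Y /\ app f Y F).
  assert (phiD : definable2 phi) by (unfold phi; def).
  assert (phiR : forall b F, phi b F -> choice_function D F /\ R b F).
  { intros b F (Y & HY & HF'). apply fm in HF'. apply HY in HF' as [HF' HRF].
    split; auto. now apply HC. }
  assert (phiU : forall b F F', phi b F -> phi b F' -> F = F').
  { intros b F F' (Y & HY & H) (Y' & HY' & H'). rewrite (Qfun _ _ _ HY' HY) in H'. eauto. }
  assert (phiE : forall b, b ∈ a -> exists F, phi b F).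
  { intros b Hb. destruct (Qex b) as [Y HY].
    destruct (proj1 (fd Y)) as [F HFY]; [apply HA; eauto|]. exists F, Y. auto. }
  destruct (choice_function_build (fun p z => forall i e, pair i e p -> i ∉ m ->
      forall b F X, b ∈ a -> phi b F -> app F p X -> z ∈ X)) as (E & HE & HEP).
  - def.
  - intros p W HW.
    destruct (system_ultrafilter p W HW) as (i & e & k & Hi & Hp & Hk & Huf & Hc).
    destruct (classic (i ∈ m)) as [Him | Him].
    { exists k. split; [apply Huf|]. intros z _ i' e' Hp' Hi'.
      destruct (pair_inj _ _ _ _ _ Hp Hp'); subst. contradiction. }
    destruct (complete_family k W (gamma_transitive i k Hk) Huf Hc
      (fun b z => forall F X, phi b F -> app F p X -> z ∈ X) a) as (X & HX & HXP).
    + def.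
    + now apply (Ha i).
    + intros b Hb. destruct (phiE b Hb) as [F Hphi].
      destruct (phiR b F Hphi) as [HFD _].
      destruct (choice_function_app F p W HFD HW) as (X & HX & HXW).
      exists X. split; auto. intros z Hz F' X' Hphi' HX'.
      rewrite (phiU _ _ _ Hphi' Hphi) in HX'.
      now rewrite (choice_function_unique F p X' X).
    + exists X. split; auto. intros z Hz i' e' _ _ b F Y Hb Hphi HY.
      now apply (HXP z b Hz Hb F).
  - exists E. split; auto. intros b Hb. destruct (phiE b Hb) as [F Hphi].
    destruct (phiR b F Hphi) as [HFD HRF].
    exists F. split; auto. split; auto.
    intros i e X Y Hi (p & Hp & HX) HY z Hz.
    apply (app2_pair F i e p Y Hp) in HY.
    now apply (HEP p X z HX Hz i e Hp Hi b F).
Qed.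

(** Monotonicity is left out, so that every element of $\gamma_k$ gives a one-step extension.
    Sequences that are not increasing will be secured vacuously. *)
Definition seq (k t : U) : Prop :=
  k ∈ w /\ function_on t k /\ (forall i a x, app t i a -> app g i x -> a ∈ x).

(** [t' = t ∪ {(k, b)}] *)
Definition snoc (t k b t' : U) : Prop := forall p : U, p ∈ t' <-> p ∈ t \/ pair k b p.

Lemma definable_seq s t : term s -> term t -> definable (fun e => seq (s e) (t e)).
Proof. unfold seq. def. Qed.

Lemma definable_snoc s t u v : term s -> term t -> term u -> term v ->
  definable (fun e => snoc (s e) (t e) (u e) (v e)).
Proof. unfold snoc. def. Qed.
Hint Resolve definable_seq definable_snoc : def.

Lemma snoc_ex t k b : exists t', snoc t k b t'.
Proof.
  destruct (pair_ex k b) as [p Hp], (adjoin_ex t p) as [t' Ht'].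
  exists t'. intros q. rewrite Ht'. split; intros [H | H]; auto.
  - subst. auto.
  - right. eauto using pair_unique.
Qed.

Lemma snoc_unique t k b t' t'' : snoc t k b t' -> snoc t k b t'' -> t' = t''.
Proof.
  intros H H'. apply (extensionality U_ZFC). intros z. now rewrite (H z), (H' z).
Qed.

Lemma snoc_app t k b t' : snoc t k b t' ->
  forall i a, app t' i a <-> app t i a \/ (i = k /\ a = b).
Proof.
  intros H i a. split.
  - intros (p & Hp & Hpt). apply H in Hpt as [Hpt | Hpt].
    + left. now exists p.
    + right. eapply pair_inj; eauto.
  - intros [(p & Hp & Hpt) | [-> ->]].
    + exists p. split; auto. apply H. auto.
    + destruct (pair_ex k b) as [p Hp]. exists p. split; auto. apply H. auto.
Qed.

Lemma seq_dom k t i : seq k t -> (i ∈ k <-> exists a, app t i a).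
Proof. intros (_ & [_ H] & _). apply H. Qed.

Lemma seq_app_mem k t i a : seq k t -> app t i a -> i ∈ k.
Proof. intros H Ha. apply (seq_dom k t i H). eauto. Qed.

Lemma seq_unique k t i a b : seq k t -> app t i a -> app t i b -> a = b.
Proof. intros (_ & [[_ H] _] & _). apply H. Qed.

Lemma snoc_seq k k' t b x t' : seq k t -> succ k k' -> k' ∈ w -> app g k x -> b ∈ x ->
  snoc t k b t' -> seq k' t'.
Proof.
  intros Ht Hs Hk' Hx Hb Hsn. pose proof (snoc_app t k b t' Hsn) as Happ.
  destruct (Ht) as (Hk & [[Hp Hf] _] & Hbd).
  split; auto. split; [split; [split|]|].
  - intros p Hpt. apply Hsn in Hpt as [Hpt | Hpt]; eauto.
  - intros i a a' H H'. apply Happ in H, H'.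
    destruct H as [H | [-> ->]], H' as [H' | [E' E'']]; subst; auto.
    + eauto.
    + exfalso. apply (mem_irrefl k). eapply seq_app_mem; eauto.
    + exfalso. apply (mem_irrefl k). eapply seq_app_mem; eauto.
  - intros i. rewrite (Hs i), (seq_dom k t i Ht). split.
    + intros [[a Ha] | ->]; [exists a | exists b]; apply Happ; auto.
    + intros [a Ha]. apply Happ in Ha as [Ha | [-> _]]; eauto.
  - intros i a y Ha Hy. apply Happ in Ha as [Ha | [-> ->]]; [eauto|].
    now rewrite (gamma_unique k y x).
Qed.

Lemma seq_pred k k' t' : seq k' t' -> succ k k' ->
  exists t b x, seq k t /\ snoc t k b t' /\ app g k x /\ b ∈ x.
Proof.
  intros Ht' Hs. destruct (Ht') as (Hk' & [[Hp Hf] Hd] & Hbd).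
  assert (Hkk : k ∈ k') by (apply Hs; auto).
  assert (Hk : k ∈ w) by (apply (omega_transitive k'); auto).
  destruct (proj1 (Hd k) Hkk) as [b Hb]. destruct (gamma_ex k Hk) as [x Hx].
  destruct (definable_separation (fun p => ~ pair k b p) t') as [t Ht]; [def|].
  assert (Happ : forall i a, app t i a <-> app t' i a /\ i <> k).
  { intros i a. split.
    - intros (p & Hpp & Hpt). apply Ht in Hpt as [Hpt Hn].
      assert (Ha : app t' i a) by now exists p.
      split; auto. intros ->. rewrite (Hf k a b) in Hpp; auto.
    - intros [(p & Hpp & Hpt) Hn]. exists p. split; auto. apply Ht. split; auto.
      intros Hp'. destruct (pair_inj _ _ _ _ _ Hpp Hp'). auto. }
  exists t, b, x. split; [|split; [|split]]; eauto.
  - split; auto. split; [split; [split|]|].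
    + intros p Hpt. apply Ht in Hpt as [Hpt _]. auto.
    + intros i a a' H H'. apply Happ in H, H'. apply (Hf i); tauto.
    + intros i. split.
      * intros Hi. destruct (proj1 (Hd i)) as [a Ha]; [apply Hs; auto|].
        exists a. apply Happ. split; auto. intros ->. now apply (mem_irrefl k).
      * intros [a Ha]. apply Happ in Ha as [Ha Hn].
        assert (Hi : i ∈ k') by (apply Hd; eauto).
        apply Hs in Hi as [Hi | Hi]; [auto | contradiction].
    + intros i a y Ha. apply Happ in Ha as [Ha _]. eauto.
  - intros p. split.
    + intros H. destruct (classic (pair k b p)); auto. left. apply Ht. auto.
    + intros [H | H]; [now apply Ht in H|]. now apply (app_pair t' k b p).
Qed.

Lemma succ_not_mem k k' i : succ k k' -> i ∈ w -> k ∈ w -> i ∉ k' -> k ∈ i.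
Proof.
  intros Hs Hi Hk H. destruct (omega_linear i k Hi Hk) as [Hik | [-> | Hik]]; auto;
    exfalso; apply H, Hs; auto.
Qed.

(** This makes intersections indexed by $\gamma_k$ available from coordinate [k'] on. *)
Lemma gamma_above k k' y i x : succ k k' -> app g k y -> i ∉ k' -> app g i x -> y ∈ x.
Proof.
  intros Hs Hy Hi Hx. destruct g_cardinals as (_ & _ & Hinc & _).
  apply (Hinc k i y x); auto.
  apply (succ_not_mem k k'); auto; eapply gamma_index; eauto.
Qed.

(** One diagonal intersection for each coordinate, so that the finite sequences
    need not be counted. *)
Lemma choice_function_diagonal_length n : n ∈ w -> forall R, definable2 R ->
  (forall t, seq n t -> exists F, choice_function D F /\ R t F) ->
  exists E, choice_function D E /\ forall t, seq n t ->
    exists F, choice_function D F /\ R t F /\ refines n E F.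
Proof.
  revert n. apply (omega_induction (fun n => forall R, _ -> _ -> _)).
  - intros n Hn Hemp R HR H.
    (* Only the empty sequence has length 0, so a single function serves. *)
    destruct (classic (exists t, seq n t)) as [[t Ht] | Hno].
    + destruct (H t Ht) as (F & HF & HRF). exists F. split; auto.
      intros t' Ht'. assert (E : t' = t).
      { apply function_ext; [apply Ht' | apply Ht |].
        intros i a. split; intros Ha.
        - now apply (seq_app_mem n t') in Ha; [apply Hemp in Ha|].
        - now apply (seq_app_mem n t) in Ha; [apply Hemp in Ha|]. }
      rewrite E. exists F. split; auto. split; auto.
      intros i a X Y _ (p & Hp & HX) HY. apply (app2_pair F i a p Y Hp) in HY.
      rewrite (choice_function_unique F p X Y); auto. intros z; auto.
    + destruct choice_function_ex as [F HF]. exists F. split; auto.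
      intros t Ht. exfalso. eauto.
  - intros n m Hn Hm Hs IH R HR H.
    (* The new relation asks [F] to serve all one-step extensions of [t] at once. Such an [F] is a
       diagonal intersection over the last values in $\gamma_n$, valid from [m] on. *)
    destruct (IH (fun t F => forall b t1, snoc t n b t1 -> seq m t1 ->
      exists F1, choice_function D F1 /\ R t1 F1 /\ refines m F F1)) as (E & HE & HEP).
    + def.
    + intros t Ht. destruct (gamma_ex n Hn) as [x Hx].
      destruct (choice_function_diagonal
        (fun b F => forall t1, snoc t n b t1 -> seq m t1 -> R t1 F) x m)
        as (E & HE & HEP).
      * def.
      * intros i y Hi Hy. now apply (gamma_above n m x i y).
      * intros b Hb. destruct (snoc_ex t n b) as [t1 Ht1].
        destruct (H t1) as (F & HF & HRF); [eapply snoc_seq; eauto|].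
        exists F. split; auto. intros t2 Ht2 _.
        now rewrite (snoc_unique _ _ _ _ _ Ht2 Ht1).
      * exists E. split; auto. intros b t1 Ht1 Hseq.
        assert (Hb : b ∈ x).
        { destruct Hseq as (_ & _ & Hbd). apply (Hbd n b); auto.
          apply (snoc_app t n b t1); auto. }
        destruct (HEP b Hb) as (F & HF & HRF & Href). exists F. auto.
    + exists E. split; auto. intros t1 Ht1.
      destruct (seq_pred n m t1 Ht1 Hs) as (t & b & x & Ht & Hsn & _ & _).
      destruct (HEP t Ht) as (F & HF & HRF & Href).
      destruct (HRF b t1 Hsn Ht1) as (F1 & HF1 & HR1 & Href1).
      exists F1. split; auto. split; auto.
      apply (refines_trans m E F F1); auto.
      apply (refines_mono n m); auto. intros z Hz. apply Hs. auto.
Qed.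

(** There is one function for each length; a further diagonal intersection over the lengths merges
    them. It takes effect at coordinates above 0, hence the restriction to nonempty [k]. *)
Lemma choice_function_diagonal_seq (R : U -> U -> Prop) : definable2 R ->
  (forall k t, nonempty k -> seq k t -> exists F, choice_function D F /\ R t F) ->
  exists E, choice_function D E /\ forall k t, nonempty k -> seq k t ->
    exists F, choice_function D F /\ R t F /\ refines k E F.
Proof.
  intros HR H. destruct omega_zero as (z & Hz & Hemp).
  destruct (omega_succ z Hz) as (one & Hone & Hs).
  destruct (gamma_ex z Hz) as [x Hx].
  (* The lengths are indexed by [γ_0 ⊇ ω], which is visibly an element of [γ_i] for [i > 0]. *)
  destruct (choice_function_diagonal (fun n E => n ∈ w -> nonempty n ->
    forall t, seq n t -> exists F, choice_function D F /\ R t F /\ refines n E F) x one)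
    as (E & HE & HEP).
  - def.
  - intros i y Hi Hy. now apply (gamma_above z one x i y).
  - intros n _. destruct (classic (n ∈ w /\ nonempty n)) as [[Hn Hne] | Hno].
    + destruct (choice_function_diagonal_length n Hn R HR) as (E & HE & HEP); eauto.
    + destruct choice_function_ex as [F HF]. exists F. split; auto. tauto.
  - exists E. split; auto. intros k t Hne Ht.
    assert (Hk : k ∈ w) by apply Ht.
    destruct (HEP k) as (E1 & HE1 & HR1 & Href1); [now apply (gamma_omega z x)|].
    destruct (HR1 Hk Hne t Ht) as (F & HF & HRF & Href).
    exists F. split; auto. split; auto.
    apply (refines_trans k E E1 F); auto. apply (refines_mono one k); auto.
    intros y Hy. apply Hs in Hy as [Hy | ->]; [now apply Hemp in Hy|].
    destruct (omega_linear z k Hz Hk) as [Hzk | [-> | Hkz]]; auto; exfalso.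
    + destruct Hne as [v Hv]. now apply (Hemp v).
    + now apply (Hemp k).
Qed.

(** * Meeting dense sets along a branch *)

(** [follows] for a sequence that may lie outside the model, given as a relation. For
    [sigma := app s] the two notions are convertible. *)
Definition followed (sigma : U -> U -> Prop) (F i : U) : Prop :=
  exists j a b X, succ j i /\ sigma j a /\ sigma i b /\ app2 F i a X /\ b ∈ X.

Lemma followed_mono (sigma tau : U -> U -> Prop) F i :
  (forall j a, sigma j a -> tau j a) -> followed sigma F i -> followed tau F i.
Proof. intros H (j & a & b & X & ?). exists j, a, b, X. intuition. Qed.

Lemma followed_refines sigma m F E i : choice_function D F -> choice_function D E ->
  refines m F E -> i ∉ m -> followed sigma F i -> followed sigma E i.
Proof.
  intros HF HE H Hi (j & a & b & X & Hs & Ha & Hb & (p & Hp & HX) & Hm).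
  destruct (choice_function_dom F E p X HF HE HX) as [Y HY].
  exists j, a, b, Y. split; auto. split; auto. split; auto.
  split; [now exists p|]. apply (H i a X Y); auto; now exists p.
Qed.

Lemma refines_refl m F : choice_function D F -> refines m F F.
Proof.
  intros HF i a X Y _ (p & Hp & HX) HY. apply (app2_pair F i a p Y Hp) in HY.
  rewrite (choice_function_unique F p X Y); auto. intros z; auto.
Qed.

Lemma dom_unique (f d d' : U) : dom f d -> dom f d' -> d = d'.
Proof.
  intros H H'. apply (extensionality U_ZFC). intros z. now rewrite (H z), (H' z).
Qed.

Lemma app_subset (f f' x y : U) : subset f f' -> app f x y -> app f' x y.
Proof. intros H (p & Hp & Hf). exists p. auto. Qed.

Lemma function_subset (f f' : U) : function f ->
  (forall x y, app f x y -> app f' x y) -> subset f f'.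
Proof.
  intros [Hf _] H p Hp. destruct (Hf p Hp) as (x & y & Hxy).
  apply (app_pair f' x y p Hxy), H. now exists p.
Qed.

Lemma seq_dom_is k t : seq k t -> dom t k.
Proof. intros (_ & [_ H] & _). exact H. Qed.

Lemma seq_eq k t t' : seq k t -> seq k t' -> subset t t' -> t = t'.
Proof.
  intros Ht Ht' H. apply function_ext; [apply Ht | apply Ht' |].
  intros i a. split; [now apply app_subset|]. intros Ha.
  destruct (proj1 (seq_dom k t i Ht)) as [b Hb]; [now apply (seq_app_mem k t' i a)|].
  rewrite (seq_unique k t' i a b); auto. eapply app_subset; eauto.
Qed.

Lemma omega_zero_mem z k : empty z -> z ∈ w -> k ∈ w -> nonempty k -> z ∈ k.
Proof.
  intros Hemp Hz Hk [y Hy].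
  destruct (omega_linear z k Hz Hk) as [H | [-> | H]]; auto; exfalso.
  - now apply (Hemp y).
  - now apply (Hemp k).
Qed.

Lemma omega_above m n : m ∈ w -> n ∈ w -> exists k, k ∈ w /\ m ∈ k /\ n ∈ k.
Proof.
  intros Hm Hn. destruct (omega_succ m Hm) as (m' & Hm' & Hsm).
  destruct (omega_succ n Hn) as (n' & Hn' & Hsn).
  assert (m ∈ m') by (apply Hsm; auto). assert (n ∈ n') by (apply Hsn; auto).
  destruct (omega_linear m n Hm Hn) as [H1 | [-> | H1]].
  - exists n'. split; auto. split; auto. apply Hsn. auto.
  - exists n'. auto.
  - exists m'. split; auto. split; auto. apply Hsm. auto.
Qed.

Lemma increasing_subset (t t' : U) : subset t t' -> increasing t' -> increasing t.
Proof.
  intros H H' i j x y Hx Hy. apply H'; eapply app_subset; eauto.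
Qed.

Lemma definable_condition s : term s -> definable (fun e => condition w g D (s e)).
Proof. unfold condition. def. Qed.
Hint Resolve definable_condition : def.

(** * Secured sequences *)

Section Dense.
Variable A : U.
Hypothesis A_dense : dense w g D A.

(** [(t, F)] is compatible with some [q = (s, E) ∈ A] with [s ⊆ t].  Below [k] the
    values of [F] are not constrained, which lets [F] be pieced together. *)
Definition witness (k t F : U) : Prop :=
  exists q s E l, q ∈ A /\ pair s E q /\ dom s l /\ subset s t /\
    (forall i, i ∈ k -> i ∉ l -> follows E t i) /\ refines k F E.

(** [k] is meant to be the length of [t]; what happens below [k] is already decided and need not
    follow [F]. The bound [m] exempts extensions that are still too short to reveal how [t] is
    continued. *)
Definition secured_by (F m k t : U) : Prop :=
  forall k' t', seq k' t' -> increasing t' -> subset t t' -> m ∈ k' ->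
    (forall i, i ∈ k' -> i ∉ k -> follows F t' i) -> witness k' t' F.

Definition secured (k t : U) : Prop :=
  exists F m, choice_function D F /\ m ∈ w /\ secured_by F m k t.

Lemma definable_secured_by s t u v : term s -> term t -> term u -> term v ->
  definable (fun e => secured_by (s e) (t e) (u e) (v e)).
Proof. unfold secured_by, witness. def. Qed.
Hint Resolve definable_secured_by : def.

Lemma definable_secured s t :
  term s -> term t -> definable (fun e => secured (s e) (t e)).
Proof. unfold secured. def. Qed.
Hint Resolve definable_secured : def.

Lemma secured_of_snoc k k' t j a p W X : seq k t -> succ j k -> succ k k' ->
  app t j a -> pair k a p -> app D p W -> X ∈ W ->
  (forall b t', b ∈ X -> snoc t k b t' -> secured k' t') -> secured k t.
Proof.
  intros Ht Hj Hk' Ha Hp HW HX Hsec.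
  assert (Hk : k ∈ w) by apply Ht.
  destruct (system_ultrafilter p W HW) as (k0 & a0 & y & _ & Hp0 & Hy & Huf & Hc).
  destruct (pair_inj _ _ _ _ _ Hp Hp0); subst k0 a0. clear Hp0.
  pose proof (gamma_transitive k y Hy) as Hty.
  (* Otherwise for each [m] almost no [b] has bound [m]; intersect over all [m]. *)
  assert (Hm : exists m X1, m ∈ w /\ X1 ∈ W /\ forall b, b ∈ X1 ->
    exists F, choice_function D F /\
      forall t', snoc t k b t' -> secured_by F m k' t').
  { apply NNPP. intros Hno.
    (* The bounds are indexed by $\gamma_0\supseteq\omega$, which is an element of $\gamma_k$
       because [k] is a successor. *)
    destruct omega_zero as (z & Hz & Hemp). destruct (gamma_ex z Hz) as [x Hx].
    destruct (complete_family y W Hty Huf Hc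
      (fun m b => m ∈ w -> ~ exists F, choice_function D F /\
         forall t', snoc t k b t' -> secured_by F m k' t') x) as (X2 & HX2 & HX2P).
    - def.
    - destruct g_cardinals as (_ & _ & Hinc & _). apply (Hinc z k x y); auto.
      apply omega_zero_mem; auto. exists j. apply Hj. auto.
    - intros m _. destruct (classic (m ∈ w)) as [Hmw | Hmw].
      + destruct (ultrafilter_em y W Huf (fun b => exists F, choice_function D F /\
         forall t', snoc t k b t' -> secured_by F m k' t')) as [(X1 & H1 & H2) | (X1 & H1 & H2)].
        * def.
        * exfalso. apply Hno. exists m, X1. split; auto. split; auto. apply H2.
        * exists X1. split; auto. intros b Hb _. now apply H2.
      + exists X. split; auto.
    - destruct (ultrafilter_inter2 y W Huf X X2 HX HX2) as (X3 & HX3 & H3).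
      destruct (ultrafilter_inhabited y W Huf X3 HX3) as [b Hb].
      apply H3 in Hb as [HbX Hb2].
      destruct (snoc_ex t k b) as [t1 Ht1].
      destruct (Hsec b t1 HbX Ht1) as (F & m & HF & Hmw & Hs).
      apply (HX2P b m); auto.
      + apply (gamma_omega z x); auto.
      + exists F. split; auto. intros t2 Ht2.
        now rewrite (snoc_unique _ _ _ _ _ Ht2 Ht1). }
  destruct Hm as (m & X1 & Hmw & HX1 & HX1P).
  (* One function for all next values [b], valid from [k'] on; values outside [X1] receive a
     default. *)
  destruct (choice_function_diagonal (fun b F => b ∈ X1 ->
    forall t', snoc t k b t' -> secured_by F m k' t') y k') as (F1 & HF1 & HF1P).
  { def. }
  { intros i x Hi Hx. now apply (gamma_above k k' y i x). }
  { intros b _. destruct (classic (b ∈ X1)) as [Hb | Hb].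
    - destruct (HX1P b Hb) as (F & HF & HFP). exists F. auto.
    - destruct choice_function_ex as [F HF]. exists F. tauto. }
  (* Coordinate [k] is not reached by this intersection. There [F] is cut down to [X1] at
     [p = (k, a)], which forces the next value into [X1]. *)
  destruct (choice_function_build (fun q z =>
    (forall Y, app F1 q Y -> z ∈ Y) /\ (q = p -> z ∈ X1))) as (F & HF & HFP).
  { def. }
  { intros q W' HW'.
    destruct (system_ultrafilter q W' HW') as (k1 & a1 & y1 & _ & _ & _ & Huf' & _).
    destruct (choice_function_app F1 q W' HF1 HW') as (Y & HY & HYW).
    destruct (classic (q = p)) as [-> | Hq].
    - assert (W' = W) by (destruct D_ultrafilters as ([_ HD] & _); eauto). subst W'.
      destruct (ultrafilter_inter2 y W Huf Y X1 HYW HX1) as (Z & HZ & HZP).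
      exists Z. split; auto. intros z Hz. apply HZP in Hz as [Hz Hz1]. split; auto.
      intros Y' HY'. now rewrite (choice_function_unique F1 p Y' Y).
    - exists Y. split; auto. intros z Hz. split; [|tauto].
      intros Y' HY'. now rewrite (choice_function_unique F1 q Y' Y). }
  assert (HFF1 : refines k F F1).
  { intros i e Z Y _ (q & Hq & HZ) HY z Hz. apply (app2_pair F1 i e q Y Hq) in HY.
    now apply (HFP q Z z). }
  assert (Hk'w : k' ∈ w).
  { destruct (omega_succ k Hk) as (k1 & Hk1 & Hs1). now rewrite (succ_unique _ _ _ Hk' Hs1). }
  (* The new bound also exceeds [k], so that any sequence longer than it has a value at [k]. *)
  destruct (omega_above m k Hmw Hk) as (m2 & Hm2 & Hmm2 & Hkm2).
  exists F, m2. split; auto. split; auto.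
  intros k2 t2 Ht2 Hinc Hsub Hm2k2 Hfol.
  assert (Htr : transitive k2) by (apply omega_elem_transitive, Ht2).
  assert (Hkk2 : k ∈ k2) by (apply (Htr m2); auto).
  destruct (Hfol k Hkk2 (mem_irrefl k)) as (j' & a' & b & Z & Hj' & Ha' & Hb & HZ & HbZ).
  rewrite (succ_inj _ _ _ Hj' Hj) in Ha'.
  rewrite (seq_unique k2 t2 j a' a Ht2 Ha' (app_subset t t2 j a Hsub Ha)) in HZ.
  assert (HbX1 : b ∈ X1).
  { apply (app2_pair F k a p Z Hp) in HZ. now apply (HFP p Z b). }
  assert (Hby : b ∈ y) by (destruct Ht2 as (_ & _ & Hbd); eauto).
  destruct (HF1P b Hby) as (F2 & HF2 & HR2 & Href2).
  destruct (snoc_ex t k b) as [t1 Ht1].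
  assert (HkF2 : refines k' F F2).
  { apply (refines_trans k' F F1 F2); auto. apply (refines_mono k k'); auto.
    intros z Hz. apply Hk'. auto. }
  (* [t2] extends [t1], which is [t] with the value [b] added, and [F2] secures [t1] with the common
     bound [m]. *)
  destruct (HR2 HbX1 t1 Ht1 k2 t2) as (q & s & E & l & Hq & Hqp & Hl & Hst & HqF & Href); auto.
  - apply function_subset.
    + apply (snoc_seq k k' t b y t1 Ht Hk' Hk'w Hy Hby Ht1).
    + intros i e He. apply (snoc_app t k b t1 Ht1) in He as [He | [-> ->]]; auto.
      eapply app_subset; eauto.
  - apply (Htr m2); auto.
  - intros i Hi Hik'. apply (followed_refines (app t2) k' F F2); auto.
    apply Hfol; auto. intros Hik. apply Hik', Hk'. auto.
  - exists q, s, E, l. split; auto. split; auto. split; auto. split; auto. split; auto.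
    apply (refines_trans k2 F F2 E); auto.
    apply (refines_mono k' k2); auto. intros z Hz. apply Hk' in Hz as [Hz | ->]; auto.
    apply (Htr k); auto.
Qed.

(** If [t] is not secured, neither are almost all its one-step extensions.  A
    choice function that keeps to those would yield a condition without any
    extension in [A]. *)
Lemma all_secured k t : nonempty k -> seq k t -> secured k t.
Proof.
  intros Hne0 Ht0. apply NNPP. intros Hns0.
  (* A sequence that is not increasing has no increasing extension, so it is secured by anything. *)
  assert (Hinc0 : increasing t).
  { apply NNPP. intros Hninc. apply Hns0.
    destruct choice_function_ex as [F HF]. exists F, k. split; auto. split; [apply Ht0|].
    intros k' t' _ Hinc Hsub. exfalso. apply Hninc. eapply increasing_subset; eauto. }
  (* The function attached to an unsecured [t] admits, at the coordinate after [t], only values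
     whose addition leaves [t] unsecured. Secured sequences impose nothing. *)
  destruct (choice_function_diagonal_seq (fun t F => forall k k' j a b t' X,
    dom t k -> succ j k -> app t j a -> ~ secured k t -> succ k k' ->
    app2 F k a X -> b ∈ X -> snoc t k b t' -> ~ secured k' t')) as (E & HE & HEP).
  - def.
  - intros k1 t1 Hne Ht. destruct (classic (secured k1 t1)) as [Hs | Hns].
    { destruct choice_function_ex as [F HF]. exists F. split; auto.
      intros k2 k' j a b t' X Hd _ _ Hns. exfalso. apply Hns.
      now rewrite (dom_unique _ _ _ Hd (seq_dom_is k1 t1 Ht)). }
    assert (Hk1 : k1 ∈ w) by apply Ht.
    destruct (omega_pred k1 Hk1 Hne) as (j & Hj & Hjs).
    destruct (omega_succ k1 Hk1) as (k1' & Hk1' & Hs').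
    destruct (proj1 (seq_dom k1 t1 j Ht)) as [a Ha]; [apply Hjs; auto|].
    destruct (gamma_ex j Hj) as [x Hx].
    assert (Hax : a ∈ x) by (destruct Ht as (_ & _ & Hbd); eauto).
    destruct (system_app2 k1 j a x Hk1 Hjs Hx Hax) as (p & y & W & Hp & HW & Hy & Huf & Hc).
    destruct (ultrafilter_em y W Huf (fun b => exists t', snoc t1 k1 b t' /\ secured k1' t'))
      as [(X & HX & HXP) | (X & HX & HXP)].
    + def.
    + exfalso. apply Hns. apply (secured_of_snoc k1 k1' t1 j a p W X); auto.
      intros b t' Hb Ht'. destruct (HXP b Hb) as (_ & t2 & Ht2 & Hsec).
      now rewrite (snoc_unique _ _ _ _ _ Ht' Ht2).
    + destruct (choice_function_build (fun q b => q = p ->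
        ~ exists t', snoc t1 k1 b t' /\ secured k1' t')) as (F & HF & HFP).
      * def.
      * intros q W' HW'. destruct (classic (q = p)) as [-> | Hq].
        -- assert (W' = W) by (destruct D_ultrafilters as ([_ HD] & _); eauto). subst W'.
           exists X. split; auto. intros z Hz _. now apply HXP.
        -- destruct (system_ultrafilter q W' HW') as (k2 & a1 & y1 & _ & _ & _ & Huf' & _).
           exists y1. split; [apply Huf' | tauto].
      * exists F. split; auto.
        intros k2 k' j' a' b t' Y Hd Hj' Ha' _ Hk' HY HbY Ht' Hsec.
        assert (k2 = k1) by exact (dom_unique _ _ _ Hd (seq_dom_is k1 t1 Ht)). subst k2.
        rewrite (succ_inj _ _ _ Hj' Hjs) in Ha'.
        rewrite (seq_unique k1 t1 j a' a) in HY; auto.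
        apply (app2_pair F k1 a p Y Hp) in HY.
        apply (HFP p Y b HY HbY eq_refl). exists t'. split; auto.
        now rewrite (succ_unique _ _ _ Hs' Hk').
  - destruct (pair_ex t E) as [p Hp]. destruct A_dense as [HA HAd].
    destruct (HAd p) as (q & Hq & Hqp).
    { exists t, E. split; auto. split; [|split; [|split]]; auto.
      - exists k. split; [apply Ht0|]. split; auto. exact (proj1 (proj2 Ht0)).
      - exact (proj2 (proj2 Ht0)). }
    destruct Hqp as (s' & F' & s & F & k' & k0 & Hq' & Hp' & Hk' & Hk0 & Hle & Hagree & Hsub & Hfol).
    destruct (pair_inj _ _ _ _ _ Hp Hp'); subst s F.
    assert (k0 = k) by exact (dom_unique _ _ _ Hk0 (seq_dom_is k t Ht0)). subst k0.
    destruct (HA q Hq) as (s2 & F2 & Hq2 & (k2 & Hk2 & Hne2 & Hs2) & Hinc2 & Hbd2 & HF2).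
    destruct (pair_inj _ _ _ _ _ Hq' Hq2); subst s2 F2.
    assert (k2 = k') by exact (dom_unique _ _ _ (proj2 Hs2) Hk'). subst k2.
    assert (Hs' : seq k' s') by (split; auto).
    assert (Hts : subset t s').
    { apply function_subset; [apply Ht0|]. intros i a Ha. apply Hagree; auto.
      eapply seq_app_mem; eauto. }
    (* From [t] up to the stem [s'] of [q], following [E] keeps every restriction unsecured. *)
    assert (Hns : forall n, n ∈ w -> forall t1, seq n t1 -> subset t1 s' -> le k n ->
      ~ secured n t1).
    { apply (omega_induction (fun n => forall t1, _ -> _ -> _ -> _)).
      - intros n Hn Hemp t1 _ _ [Hkn | <-].
        + now apply Hemp in Hkn.
        + destruct Hne0 as [z Hz]. now apply Hemp in Hz.
      - intros n m Hn Hm Hs IH t1 Ht1 Hsub1 Hkm.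
        destruct Hkm as [Hkm | <-].
        2: { rewrite (seq_eq k t1 t); auto. apply function_subset; [apply Ht1|].
             intros i a Ha. apply Hagree; [eapply seq_app_mem; eauto|].
             eapply app_subset; eauto. }
        assert (Hkn : le k n) by now apply Hs.
        destruct (seq_pred n m t1 Ht1 Hs) as (t2 & b & x & Ht2 & Hsn & Hx & Hb).
        assert (Hsub2 : subset t2 t1) by (intros z Hz; apply Hsn; auto).
        assert (Hnen : nonempty n).
        { destruct Hkn as [Hkn | <-]; [now exists k | auto]. }
        destruct (HEP n t2 Hnen Ht2) as (F & HF & HR & Href).
        assert (Hbs : app s' n b).
        { apply (app_subset t1); auto. apply (snoc_app t2 n b t1 Hsn). auto. }
        destruct (Hfol n) as (j & a & b' & X & Hj & Ha & Hb' & HX & HbX).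
        { apply Hk'. eauto. }
        { intros Hnk. destruct Hkn as [Hkn | ->].
          - now apply (mem_asym n k).
          - now apply (mem_irrefl n). }
        rewrite (seq_unique k' s' n b' b) in HbX; auto.
        destruct (HX) as (r & Hr & HXr).
        destruct (choice_function_dom E F r X HE HF HXr) as [Y HY].
        assert (HYn : app2 F n a Y) by now exists r.
        apply (HR n m j a b t1 Y); auto.
        + apply Ht2.
        + destruct (proj1 (seq_dom n t2 j Ht2)) as [a2 Ha2]; [apply Hj; auto|].
          rewrite (seq_unique k' s' j a a2); auto.
          apply (app_subset t1); auto. now apply (app_subset t2).
        + apply (IH t2); auto. intros z Hz. auto.
        + apply (Href n a X Y); auto. apply mem_irrefl. }
    (* Yet [s'] is secured by its own [F'] with bound 0: [q] is the witness for each extension that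
       follows [F']. *)
    apply (Hns k' (proj1 Hs') s' Hs'); auto; [intros z; auto|].
    destruct omega_zero as (z & Hz & _).
    exists F', z. split; auto. split; auto.
    intros k3 t3 _ _ Hsub3 _ Hfol3. exists q, s', F', k'.
    split; auto. split; auto. split; auto. split; auto. split; auto.
    now apply refines_refl.
Qed.

End Dense.

(** * Branches outside the model and the conditions along them *)

Definition branch (sigma : U -> U -> Prop) : Prop :=
  (forall i a b, sigma i a -> sigma i b -> a = b) /\
  (forall i, i ∈ w <-> exists a, sigma i a) /\
  (forall i a x, sigma i a -> app g i x -> a ∈ x) /\
  (forall i j a b, sigma i a -> sigma j b -> i ∈ j -> a ∈ b).

(** The filter [G] of the branch, as a predicate because it need not be definable in the model. *)
Definition on_branch (sigma : U -> U -> Prop) (p : U) : Prop :=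
  condition w g D p /\
  exists s F l, pair s F p /\ dom s l /\ (forall i a, app s i a -> sigma i a) /\
    (forall i, i ∈ w -> i ∉ l -> followed sigma F i).

Lemma condition_inv p s F : condition w g D p -> pair s F p ->
  choice_function D F /\ increasing s /\ exists k, nonempty k /\ seq k s.
Proof.
  intros (s' & F' & Hp' & (k & Hk & Hne & Hs) & Hinc & Hbd & HF) Hp.
  destruct (pair_inj _ _ _ _ _ Hp Hp'); subst s' F'.
  split; auto. split; auto. exists k. split; auto. split; auto.
Qed.

Lemma condition_intro k s F p : choice_function D F -> increasing s -> nonempty k ->
  seq k s -> pair s F p -> condition w g D p.
Proof.
  intros HF Hinc Hne (Hk & Hs & Hbd) Hp. exists s, F. split; auto.
  split; [exists k; auto | auto].
Qed.

(** Separation needs a set to start from, both for dense sets in the model and for the filter in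
    [V]. *)
Lemma condition_bound : exists K, forall p, condition w g D p -> p ∈ K.
Proof.
  destruct choice_functions_set as [C HC].
  destruct (app_mem_union2 g) as [u Hu], (union U_ZFC u) as [v Hv].
  destruct (product_bound w v) as [b Hb], (power U_ZFC b) as [B HB].
  destruct (product_bound B C) as [K HK].
  exists K. intros p (s & F & Hp & (k & Hk & _ & (Hs & _) & Hd) & _ & Hbd & HF).
  apply (HK s F); auto; [|now apply HC].
  apply HB. intros q Hq. destruct (Hs q Hq) as (i & a & Hia).
  assert (Ha : app s i a) by now exists q.
  assert (Hi : i ∈ w) by (apply (omega_transitive k); auto; apply Hd; eauto).
  destruct (gamma_ex i Hi) as [x Hx].
  apply (Hb i a); auto. apply Hv. exists x. split; [now apply (Hu i x) | eauto].
Qed.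

Section Branch.
Variable sigma : U -> U -> Prop.
Hypothesis sigma_branch : branch sigma.

(** The restrictions belong to the model even if [sigma] does not: an induction from outside adds
    one pair at a time. *)
Lemma branch_restriction k : k ∈ w ->
  exists t, seq k t /\ forall i a, app t i a <-> i ∈ k /\ sigma i a.
Proof.
  destruct sigma_branch as (Hfun & Hdom & Hbd & _).
  revert k. apply omega_induction.
  - intros k Hk Hemp.
    (* This is the empty set. *)
    destruct (definable_separation (fun z => z ∈ z) w) as [t Ht]; [def|].
    assert (Hte : empty t) by (intros z Hz; apply Ht in Hz; now apply (mem_irrefl z)).
    assert (Happ : forall i a, ~ app t i a) by (intros i a (p & _ & Hp); now apply Hte in Hp).
    exists t. split.
    + split; auto. split; [split; [split|]|].
      * intros p Hp. now apply Hte in Hp.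
      * intros x y y' H. now apply Happ in H.
      * intros i. split; [intros Hi; now apply Hemp in Hi | intros [a Ha]; now apply Happ in Ha].
      * intros i a x H. now apply Happ in H.
    + intros i a. split; [intros H; now apply Happ in H | intros [Hi _]; now apply Hemp in Hi].
  - intros n m Hn Hm Hs (t & Ht & Happ).
    destruct (proj1 (Hdom n) Hn) as [b Hb]. destruct (gamma_ex n Hn) as [x Hx].
    destruct (snoc_ex t n b) as [t' Ht']. exists t'. split.
    + apply (snoc_seq n m t b x t'); auto. now apply (Hbd n).
    + intros i a. rewrite (snoc_app t n b t' Ht'), Happ, (Hs i). split.
      * intros [[Hi Ha] | [-> ->]]; auto.
      * intros [[Hi | ->] Ha]; [auto | eauto].
Qed.

Lemma follows_restriction k s F i : k ∈ w -> dom s k ->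
  (forall i a, app s i a -> sigma i a) -> i ∈ k -> followed sigma F i -> follows F s i.
Proof.
  intros Hk Hd Hs Hi (j & a & b & X & Hj & Ha & Hb & HX & HbX).
  assert (Hval : forall i a, i ∈ k -> sigma i a -> app s i a).
  { intros i' a' Hi' Ha'. apply Hd in Hi' as [a'' Ha''].
    now rewrite (proj1 sigma_branch i' a' a''); auto. }
  exists j, a, b, X. split; auto. split; [|auto].
  apply Hval; auto. apply (omega_elem_transitive k Hk i); auto. apply Hj. auto.
Qed.

Lemma branch_increasing s : (forall i a, app s i a -> sigma i a) -> increasing s.
Proof.
  intros Hs i j a b Ha Hb. destruct sigma_branch as (_ & _ & _ & Hinc). eauto.
Qed.

End Branch.

(** [E] is found before any branch is given, hence in the model; this is what allows the assumption
    on [S] to be applied to it. *)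
Lemma dense_met_by_branches A : dense w g D A ->
  exists E, choice_function D E /\ forall sigma n, branch sigma -> n ∈ w -> nonempty n ->
    (forall i, i ∈ w -> i ∉ n -> followed sigma E i) ->
    exists q, q ∈ A /\ on_branch sigma q.
Proof.
  intros HA.
  (* Only the functions are merged. The bounds may vary with [t], since in the end a single
     restriction of the branch is used. *)
  destruct (choice_function_diagonal_seq (fun t F => forall k, dom t k ->
    exists m, m ∈ w /\ secured_by A F m k t)) as (E & HE & HEP).
  - pose proof (definable_secured_by A). def.
  - intros k t Hne Ht. destruct (all_secured A HA k t Hne Ht) as (F & m & HF & Hm & Hs).
    exists F. split; auto. intros k' Hk'.
    rewrite (dom_unique _ _ _ Hk' (seq_dom_is k t Ht)). eauto.
  - exists E. split; auto. intros sigma n Hb Hn Hne Hfol.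
    destruct (branch_restriction sigma Hb n Hn) as (t & Ht & Htapp).
    destruct (HEP n t Hne Ht) as (F & HF & HR & Href).
    destruct (HR n (seq_dom_is n t Ht)) as (m & Hm & Hsec).
    destruct (omega_above m n Hm Hn) as (k & Hk & Hmk & Hnk).
    destruct (branch_restriction sigma Hb k Hk) as (t' & Ht' & Htapp').
    assert (Hsub : subset n k) by now apply (omega_elem_transitive k Hk).
    assert (Hsig : forall i a, app t' i a -> sigma i a) by (intros i a H; now apply Htapp').
    assert (HfolF : forall i, i ∈ w -> i ∉ n -> followed sigma F i).
    { intros i Hi Hin. apply (followed_refines sigma n E F); auto. }
    destruct (Hsec k t') as (q & s & E' & l & Hq & Hqp & Hl & Hst & HqF & HqR); auto.
    + now apply (branch_increasing sigma).
    + apply function_subset; [apply Ht|]. intros i a Ha.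
      apply Htapp in Ha as [Hi Ha]. apply Htapp'. auto.
    + intros i Hi Hin.
      apply (follows_restriction sigma Hb k); auto; [now apply seq_dom_is|].
      apply HfolF; auto. now apply (omega_transitive k).
    + assert (Hqc : condition w g D q) by now apply HA.
      exists q. split; auto. split; auto. exists s, E', l.
      split; auto. split; auto. split.
      * intros i a Ha. apply Hsig. eapply app_subset; eauto.
      (* Below [k] the witness says that [t'] follows [E']; from [k] on the branch follows [F],
         which refines [E'] there. So [q] itself lies on the branch. *)
      * intros i Hi Hil. destruct (classic (i ∈ k)) as [Hik | Hik].
        -- apply (followed_mono (app t')); auto. now apply HqF.
        -- apply (followed_refines sigma k F E'); auto.
           now destruct (condition_inv q s E' Hqc Hqp).
Qed.

Section BranchFilter.
Variable sigma : U -> U -> Prop.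
Hypothesis sigma_branch : branch sigma.
Hypothesis sigma_follows : forall F, choice_function D F ->
  exists n, n ∈ w /\ nonempty n /\ forall i, i ∈ w -> i ∉ n -> followed sigma F i.

Lemma on_branch_dense A : dense w g D A -> exists q, q ∈ A /\ on_branch sigma q.
Proof.
  intros HA. destruct (dense_met_by_branches A HA) as (E & HE & H).
  destruct (sigma_follows E HE) as (n & Hn & Hne & Hfol). eauto.
Qed.

Lemma on_branch_weaker p q : condition w g D p -> on_branch sigma q -> stronger q p ->
  on_branch sigma p.
Proof.
  intros Hp (Hq & s2 & F2 & l & Hqp & Hl & Hs2 & Hfol2)
    (s' & F' & s & F & k' & k & Hq' & Hp' & Hk' & Hk & Hle & Hag & Hsub & Hfol).
  destruct (pair_inj _ _ _ _ _ Hqp Hq'); subst s2 F2.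
  assert (l = k') by exact (dom_unique _ _ _ Hl Hk'). subst l.
  destruct (condition_inv p s F Hp Hp') as (HF & _).
  destruct (condition_inv q s' F' Hq Hq') as (HF' & _).
  split; auto. exists s, F, k. split; auto. split; auto. split.
  - intros i a Ha. apply Hs2, Hag; auto. apply Hk. eauto.
  - intros i Hi Hik. destruct (classic (i ∈ k')) as [Hik' | Hik'].
    + apply (followed_mono (app s')); auto. now apply Hfol.
    + apply (followed_refines sigma k' F' F); auto.
      intros j a X Y _ (r & Hr & HX) HY. apply (app2_pair F j a r Y Hr) in HY. eauto.
Qed.

(** Stems along one branch agree automatically, so only lengths and choice functions remain to be
    compared. *)
Lemma stronger_on_branch k k' s s' F H p r : k ∈ w -> k' ∈ w -> le k k' ->
  dom s k -> dom s' k' -> pair s F p -> pair s' H r ->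
  (forall i a, app s i a -> sigma i a) -> (forall i a, app s' i a -> sigma i a) ->
  (forall i, i ∈ w -> i ∉ k -> followed sigma F i) ->
  (forall x X Y, app H x X -> app F x Y -> subset X Y) -> stronger r p.
Proof.
  intros Hkw Hkw' Hle Hk Hk' Hp Hr Hs Hs' Hfol Hsub.
  assert (Hkk : subset k k').
  { destruct Hle as [Hle | ->]; [now apply (omega_elem_transitive k') | intros z; auto]. }
  destruct sigma_branch as (Hfun & _).
  exists s', H, s, F, k', k. do 5 (split; auto). split; [|split; auto].
  - intros i a Hi. destruct (proj1 (Hk i) Hi) as [b Hb].
    destruct (proj1 (Hk' i) (Hkk i Hi)) as [b' Hb'].
    split; intros Ha.
    + now rewrite (Hfun i a b); auto.
    + now rewrite (Hfun i a b'); auto.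
  - intros i Hi Hik. apply (follows_restriction sigma sigma_branch k'); auto.
    apply Hfol; auto. now apply (omega_transitive k').
Qed.

Lemma on_branch_directed p q : on_branch sigma p -> on_branch sigma q ->
  exists r, on_branch sigma r /\ stronger r p /\ stronger r q.
Proof.
  intros (Hp & s & F & k & Hpp & Hk & Hs & Hfol) (Hq & s' & F' & k' & Hqp & Hk' & Hs' & Hfol').
  destruct (condition_inv p s F Hp Hpp) as (HF & _ & k0 & Hne & Hseq).
  destruct (condition_inv q s' F' Hq Hqp) as (HF' & _ & k0' & Hne' & Hseq').
  assert (k0 = k) by exact (dom_unique _ _ _ (seq_dom_is _ _ Hseq) Hk). subst k0.
  assert (k0' = k') by exact (dom_unique _ _ _ (seq_dom_is _ _ Hseq') Hk'). subst k0'.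
  assert (Hkw : k ∈ w) by apply Hseq. assert (Hkw' : k' ∈ w) by apply Hseq'.
  destruct (choice_function_inter2 F F' HF HF') as (H & HH & Hsub).
  assert (Hsub1 : forall x X Y, app H x X -> app F x Y -> subset X Y).
  { intros x X Y HX HY. destruct (choice_function_dom F F' x Y HF HF' HY) as [Z HZ].
    intros z Hz. now apply (Hsub x X Y Z) in Hz. }
  assert (Hsub2 : forall x X Y, app H x X -> app F' x Y -> subset X Y).
  { intros x X Y HX HY. destruct (choice_function_dom F' F x Y HF' HF HY) as [Z HZ].
    intros z Hz. now apply (Hsub x X Z Y) in Hz. }
  (* The common extension has the longer stem and the intersection of the two choice functions; [l]
     and [t] stand for whichever stem is longer. *)
  assert (Hmain : forall l t, nonempty l -> seq l t -> le k l -> le k' l ->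
    (forall i a, app t i a -> sigma i a) ->
    exists r, on_branch sigma r /\ stronger r p /\ stronger r q).
  { intros l t Hnel Ht Hkl Hkl' Hts. assert (Hlw : l ∈ w) by apply Ht.
    pose proof (seq_dom_is l t Ht) as Hl. destruct (pair_ex t H) as [r Hr].
    exists r. split; [|split].
    - split; [apply (condition_intro l t H); auto; now apply (branch_increasing sigma)|].
      exists t, H, l. split; auto. split; auto. split; auto.
      intros i Hi Hil.
      assert (Hik : i ∉ k).
      { intros Hik. apply Hil. destruct Hkl as [Hkl | <-]; auto.
        now apply (omega_elem_transitive l Hlw k). }
      assert (Hik' : i ∉ k').
      { intros Hik'. apply Hil. destruct Hkl' as [Hkl' | <-]; auto.
        now apply (omega_elem_transitive l Hlw k'). }
      destruct (Hfol i Hi Hik) as (j & a & b & Y & Hj & Ha & Hb & (x & Hx & HY) & HbY).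
      destruct (Hfol' i Hi Hik') as (j' & a' & b' & Z & Hj' & Ha' & Hb' & HZ & HbZ).
      destruct sigma_branch as (Hfun & _).
      rewrite (succ_inj _ _ _ Hj' Hj) in Ha'. rewrite (Hfun j a' a Ha' Ha) in HZ.
      rewrite (Hfun i b' b Hb' Hb) in HbZ. apply (app2_pair F' i a x Z Hx) in HZ.
      destruct (choice_function_dom F H x Y HF HH HY) as [X HX].
      exists j, a, b, X. do 3 (split; auto). split; [now exists x|].
      apply (Hsub x X Y Z); auto.
    - apply (stronger_on_branch k l s t F H); auto.
    - apply (stronger_on_branch k' l s' t F' H); auto. }
  destruct (omega_linear k k' Hkw Hkw') as [Hkk | [<- | Hkk]].
  - apply (Hmain k' s'); auto; [now left | now right].
  - apply (Hmain k s); auto; now right.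
  - apply (Hmain k s); auto; [now right | now left].
Qed.

(** The stem has to reach beyond [i] and also beyond the point from which the branch follows [F]. *)
Lemma on_branch_covers i a : sigma i a ->
  exists p s F, on_branch sigma p /\ pair s F p /\ app s i a.
Proof.
  intros Ha. destruct choice_function_ex as [F HF].
  destruct (sigma_follows F HF) as (n & Hn & Hne & Hfol).
  assert (Hi : i ∈ w) by (apply sigma_branch; eauto).
  destruct (omega_above n i Hn Hi) as (k & Hk & Hnk & Hik).
  destruct (branch_restriction sigma sigma_branch k Hk) as (t & Ht & Htapp).
  assert (Hts : forall j b, app t j b -> sigma j b) by (intros j b H; now apply Htapp).
  destruct (pair_ex t F) as [p Hp]. exists p, t, F. split; [|split; [auto | now apply Htapp]].
  split.
  - apply (condition_intro k t F); auto; [now apply (branch_increasing sigma) | now exists n].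
  - exists t, F, k. split; auto. split; [now apply seq_dom_is|]. split; auto.
    intros j Hj Hjk. apply Hfol; auto. intros Hjn. apply Hjk.
    now apply (omega_elem_transitive k Hk n).
Qed.

End BranchFilter.

(** * From a generic filter to eventual following *)

Section GenericFilter.
Variable G : U -> Prop.
Hypothesis G_directed : forall p q, G p -> G q ->
  exists r, G r /\ stronger r p /\ stronger r q.
Hypothesis G_dense : forall A, dense w g D A -> exists p, p ∈ A /\ G p.

Definition filter_union (i a : U) : Prop :=
  exists p s F, G p /\ pair s F p /\ app s i a.

(** Take [p = (s, E)] in [G] with [E] below [F]. A value at a coordinate beyond [s] comes from
    another member of [G]; the stem of a common extension with [p] contains that value and follows
    [E] there. *)
Lemma filter_union_follows F : (forall i, i ∈ w -> exists a, filter_union i a) ->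
  choice_function D F ->
  exists n, n ∈ w /\ nonempty n /\ forall i, i ∈ w -> i ∉ n -> followed filter_union F i.
Proof.
  intros Htotal HF. destruct condition_bound as [K HK].
  destruct (definable_separation (fun p => condition w g D p /\ exists s E, pair s E p /\
    forall q X Y, app E q X -> app F q Y -> subset X Y) K) as [A HA]; [def|].
  destruct (G_dense A) as (p & HpA & Hp).
  { split.
    - intros q Hq. now apply HA in Hq.
    - intros p Hp. destruct (Hp) as (s & E & Hpp & _).
      destruct (condition_inv p s E Hp Hpp) as (HE & Hinc & k & Hne & Hs).
      destruct (choice_function_inter2 E F HE HF) as (H & HH & HHP).
      destruct (pair_ex s H) as [q Hq].
      assert (Hqc : condition w g D q) by now apply (condition_intro k s H).
      exists q. split.
      + apply HA. split; auto. split; auto. exists s, H. split; auto.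
        intros x X Y HX HY z Hz.
        destruct (choice_function_dom F E x Y HF HE HY) as [Z HZ].
        now apply (HHP x X Z Y) in Hz.
      + exists s, H, s, E, k, k. pose proof (seq_dom_is k s Hs).
        do 4 (split; auto). split; [now right|]. split; [tauto|]. split; [|tauto].
        intros x X Y HX HY z Hz.
        destruct (choice_function_dom E F x Y HE HF HY) as [Z HZ].
        now apply (HHP x X Y Z) in Hz. }
  apply HA in HpA as (_ & Hpc & s & E & Hpp & HEF).
  destruct (condition_inv p s E Hpc Hpp) as (HE & _ & n & Hne & Hs).
  exists n. split; [apply Hs|]. split; auto. intros i Hi Hin.
  destruct (Htotal i Hi) as (b & p2 & s2 & F2 & Hp2 & Hpp2 & Hb).
  destruct (G_directed p p2 Hp Hp2) as (r & Hr & Hrp & Hrp2).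
  destruct Hrp as (s3 & F3 & s' & E' & k3 & n' & Hrr & Hp' & Hk3 & Hn' & _ & _ & _ & Hfol).
  destruct (pair_inj _ _ _ _ _ Hpp Hp'); subst s' E'.
  destruct Hrp2 as (s3' & F3' & s2' & F2' & k3' & n2 & Hrr' & Hp2' & Hk3' & Hn2 & _ & Hag & _).
  destruct (pair_inj _ _ _ _ _ Hrr Hrr'); subst s3' F3'.
  destruct (pair_inj _ _ _ _ _ Hpp2 Hp2'); subst s2' F2'.
  apply (followed_refines _ n E F); auto.
  { intros j a X Y _ (x & Hx & HX) HY. apply (app2_pair F j a x Y Hx) in HY. eauto. }
  apply (followed_mono (app s3)).
  - intros j a Ha. exists r, s3, F3. auto.
  - apply Hfol.
    + apply Hk3. exists b. apply Hag; auto. apply Hn2. eauto.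
    + now rewrite (dom_unique _ _ _ Hn' (seq_dom_is n s Hs)).
Qed.

End GenericFilter.

End System.
End SetTheory.

Arguments followed {U}.
Arguments branch {U}.
Arguments on_branch {U}.
Arguments filter_union {U}.

(** * The universe of trees and its transitive inner models *)

Lemma bisim_refl t : bisim t t.
Proof. induction t as [A f IH]. split; intros a; exists a; apply IH. Qed.

Lemma bisim_sym s : forall t, bisim s t -> bisim t s.
Proof.
  induction s as [A f IH]. intros [B h] [H1 H2]. split.
  - intros b. destruct (H2 b) as [a Ha]. exists a. now apply IH.
  - intros a. destruct (H1 a) as [b Hb]. exists b. now apply IH.
Qed.

Lemma bisim_trans s : forall t u, bisim s t -> bisim t u -> bisim s u.
Proof.
  induction s as [A f IH]. intros [B h] [C k] [H1 H2] [H3 H4]. split.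
  - intros a. destruct (H1 a) as [b Hb], (H3 b) as [c Hc]. exists c. eauto.
  - intros c. destruct (H4 c) as [b Hb], (H2 b) as [a Ha]. exists a. eauto.
Qed.

Definition class (t : tree) : V := exist _ (bisim t) (ex_intro _ t eq_refl).

Lemma class_surj (x : V) : exists t, x = class t.
Proof.
  destruct x as [P [t Ht]]. exists t. unfold class. subst P. reflexivity.
Qed.

(** Extensionality identifies the two predicates, and proof irrelevance the proofs that they are
    classes. *)
Lemma class_eq s t : bisim s t -> class s = class t.
Proof.
  intros H. apply subset_eq_compat. apply functional_extensionality. intros u.
  apply propositional_extensionality. split; intros Hu.
  - apply bisim_trans with s; auto. now apply bisim_sym.
  - now apply bisim_trans with t.
Qed.

Lemma mem_class A (f : A -> tree) (x : V) :
  x ∈ class (sup f) <-> exists a, x = class (f a).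
Proof.
  split.
  - intros (s & t & Hs & Ht & Hst). destruct (class_surj x) as [r ->]. simpl in Hs, Ht.
    destruct t as [B h]. destruct Hst as [b Hb]. destruct Ht as [_ H2].
    destruct (H2 b) as [a Ha]. exists a. apply class_eq.
    apply bisim_trans with s; auto. apply bisim_trans with (h b); auto.
    now apply bisim_sym.
  - intros [a ->]. exists (f a), (sup f).
    split; [apply bisim_refl|]. split; [apply (bisim_refl (sup f))|].
    exists a. apply bisim_refl.
Qed.

Lemma V_extensionality (x y : V) : (forall z, z ∈ x <-> z ∈ y) -> x = y.
Proof.
  intros H. destruct (class_surj x) as [[A f] ->], (class_surj y) as [[B h] ->].
  assert (E : forall s t, class s = class t -> bisim s t).
  { intros s t Hst. assert (Hb : proj1_sig (class s) t) by (rewrite Hst; apply bisim_refl).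
    exact Hb. }
  apply class_eq. split.
  - intros a. destruct (proj1 (mem_class B h (class (f a)))) as [b Hb].
    + apply H, mem_class. eauto.
    + exists b. auto.
  - intros b. destruct (proj1 (mem_class A f (class (h b)))) as [a Ha].
    + apply H, mem_class. eauto.
    + exists a. auto.
Qed.

Lemma V_induction (P : V -> Prop) :
  (forall x, (forall y, y ∈ x -> P y) -> P x) -> forall x, P x.
Proof.
  intros H x. destruct (class_surj x) as [t ->].
  induction t as [A f IH]. apply H. intros y Hy. apply mem_class in Hy as [a ->]. auto.
Qed.

(** The outer universe separates by arbitrary predicates, since the index type of a tree can be cut
    down to a subtype. *)
Lemma V_separation (x : V) (P : V -> Prop) : exists u : V, forall z, z ∈ u <-> z ∈ x /\ P z.
Proof.
  destruct (class_surj x) as [[A f] ->].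
  exists (class (@sup {a | P (class (f a))} (fun a => f (proj1_sig a)))).
  intros z. rewrite !mem_class. split.
  - intros [[a Ha] ->]. eauto.
  - intros [[a ->] Ha]. now exists (exist _ a Ha).
Qed.

(** * Absoluteness for transitive inner models *)

Section InnerModel.
Variable M : V -> Prop.
Hypothesis M_transitive : transitive_class M.

Lemma val_inj (x y : inner M) : val x = val y -> x = y.
Proof. destruct x, y. apply subset_eq_compat. Qed.

Lemma val_surj (v : V) : M v -> exists x : inner M, v = val x.
Proof. intros H. now exists (exist _ v H). Qed.

Lemma mem_val (v : V) (y : inner M) : v ∈ val y -> exists x : inner M, v = val x /\ x ∈ y.
Proof.
  intros H. destruct (val_surj v) as [x ->].
  - apply (M_transitive _ _ (proj2_sig y) H).
  - exists x. auto.
Qed.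

Lemma inner_induction (P : inner M -> Prop) :
  (forall x, (forall y, y ∈ x -> P y) -> P x) -> forall x, P x.
Proof.
  intros H. assert (HV : forall v, forall x, v = val x -> P x).
  { apply (V_induction (fun v => forall x, v = val x -> P x)).
    intros v IH x ->. apply H. intros y Hy. now apply (IH (val y) Hy). }
  intros x. now apply (HV (val x)).
Qed.

(** Transitivity returns every element of a set of the model to the model, so bounded notions like
    this one mean the same in [M] and in [V]. *)
Lemma val_upair (a b p : inner M) : upair a b p <-> upair (val a) (val b) (val p).
Proof.
  split; intros H z.
  - split.
    + intros Hz. destruct (mem_val z p Hz) as (x & -> & Hx).
      apply H in Hx as [-> | ->]; auto.
    + intros [-> | ->]; apply H; auto.
  - specialize (H (val z)). split.
    + intros Hz. apply H in Hz as [Hz | Hz]; apply val_inj in Hz; auto.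
    + intros [-> | ->]; apply H; auto.
Qed.

Lemma val_pair (a b p : inner M) : pair a b p <-> pair (val a) (val b) (val p).
Proof.
  split.
  - intros (u & v & Hu & Hv & Hp). exists (val u), (val v). now rewrite <- !val_upair.
  - intros (u & v & Hu & Hv & Hp).
    destruct (mem_val u p) as (u' & -> & _); [apply Hp; auto|].
    destruct (mem_val v p) as (v' & -> & _); [apply Hp; auto|].
    exists u', v'. now rewrite !val_upair.
Qed.

Lemma val_pair_inv (a b : V) (p : inner M) : pair a b (val p) ->
  exists a' b' : inner M, a = val a' /\ b = val b' /\ pair a' b' p.
Proof.
  intros H. destruct (H) as (u & v & Hu & Hv & Hp).
  destruct (mem_val v p) as (v' & -> & _); [apply Hp; auto|].
  destruct (mem_val a v') as (a' & -> & _); [apply Hv; auto|].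
  destruct (mem_val b v') as (b' & -> & _); [apply Hv; auto|].
  exists a', b'. split; auto. split; auto. now apply val_pair.
Qed.

Lemma val_app_inv (f : inner M) (x y : V) : app (val f) x y ->
  exists x' y' : inner M, x = val x' /\ y = val y' /\ app f x' y'.
Proof.
  intros (p & Hp & Hpf). destruct (mem_val p f Hpf) as (p' & -> & Hp').
  destruct (val_pair_inv x y p' Hp) as (x' & y' & -> & -> & Hxy).
  exists x', y'. split; auto. split; auto. now exists p'.
Qed.

Lemma val_app (f x y : inner M) : app f x y <-> app (val f) (val x) (val y).
Proof.
  split.
  - intros (p & Hp & Hpf). exists (val p). split; auto. now apply val_pair.
  - intros H. destruct (val_app_inv f _ _ H) as (x' & y' & Hx & Hy & Hf).
    apply val_inj in Hx, Hy. now subst.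
Qed.

Lemma val_succ (m n : inner M) : succ m n <-> succ (val m) (val n).
Proof.
  split; intros H z.
  - split.
    + intros Hz. destruct (mem_val z n Hz) as (x & -> & Hx).
      apply H in Hx as [Hx | ->]; auto.
    + intros [Hz | ->]; [|apply H; auto].
      destruct (mem_val z m Hz) as (x & -> & Hx). apply H. auto.
  - specialize (H (val z)). split.
    + intros Hz. apply H in Hz as [Hz | Hz]; [auto | apply val_inj in Hz; auto].
    + intros [Hz | ->]; apply H; auto.
Qed.

Lemma val_nonempty (x : inner M) : nonempty x <-> nonempty (val x).
Proof.
  split.
  - intros [z Hz]. now exists (val z).
  - intros [z Hz]. destruct (mem_val z x Hz) as (y & _ & Hy). now exists y.
Qed.

(** Lets the model speak of [S] as a relation on it, without [S] being one of its sets. *)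
Definition val_graph (S : V) (i a : inner M) : Prop := app S (val i) (val a).

(** The bound [b] brings the values of [S] into the model; in the theorem it is $\gamma$. *)
Lemma followed_val (S : V) (F i b : inner M) :
  (forall i a, app S i a -> a ∈ val b) ->
  followed (val_graph S) F i <-> follows (val F) S (val i).
Proof.
  intros HS. split.
  - intros (j & a & d & X & Hj & Ha & Hd & (p & Hp & HX) & HdX).
    exists (val j), (val a), (val d), (val X). rewrite <- val_succ.
    do 3 (split; auto). split; auto. exists (val p).
    now rewrite <- val_pair, <- val_app.
  - intros (j & a & d & X & Hj & Ha & Hd & (p & Hp & HX) & HdX).
    destruct (mem_val a b) as (a' & -> & _); [eauto|].
    destruct (mem_val d b) as (d' & -> & _); [eauto|].
    destruct (mem_val j i) as (j' & -> & _); [apply Hj; auto|].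
    destruct (val_app_inv F p X HX) as (p' & X' & -> & -> & HpX).
    exists j', a', d', X'. rewrite val_succ. do 3 (split; auto). split; auto.
    exists p'. now rewrite val_pair.
Qed.

End InnerModel.

Theorem theorem4p7 (M : V -> Prop) (M_transitive : transitive_class M)
    (M_ZFC : ZFC (inner M))
    (omega gammas gamma D : inner M)
    (omega_def : is_omega omega)
    (gammas_def : cardinal_sequence omega gammas gamma)
    (D_def : ultrafilter_system omega gammas D)
    (S : V) (S_maps : maps S (val omega) (val gamma))
    (S_increasing : increasing S)
    (S_bound : forall n a x : V, app S n a -> app (val gammas) n x -> a ∈ x) :
  generic_sequence omega gammas D S <->
  (forall F : inner M, choice_function D F ->
     exists n : V, n ∈ val omega /\ nonempty n /\
       forall i : V, i ∈ val omega -> le n i -> follows (val F) S i).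
Proof.
  pose proof (inner_induction M) as mem_ind.
  destruct S_maps as [[[S_pairs S_fun] S_dom] S_val].
  assert (S_inner : forall i a, app S i a ->
    exists i' a' : inner M, i = val i' /\ a = val a' /\ i' ∈ omega).
  { intros i a Ha.
    destruct (mem_val M M_transitive i omega) as (i' & -> & Hi); [apply S_dom; eauto|].
    destruct (mem_val M M_transitive a gamma) as (a' & -> & _); [eauto|]. eauto. }
  assert (S_total : forall i, i ∈ omega -> exists a, val_graph M S i a).
  { intros i Hi. destruct (proj1 (S_dom (val i)) Hi) as [a Ha].
    destruct (mem_val M M_transitive a gamma) as (a' & -> & _); eauto. }
  assert (S_branch : branch omega gammas (val_graph M S)).
  { split; [|split; [|split]].
    - intros i a b Ha Hb. apply val_inj. eapply S_fun; eauto.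
    - intros i. split; [apply S_total|]. intros [a Ha]. apply S_dom. eauto.
    - intros i a x Ha Hx. apply (S_bound (val i) (val a) (val x)); auto.
      now apply val_app.
    (* Stems are increasing from the start, while eventual following says nothing about the first
       values; so monotonicity is taken from [S_increasing]. *)
    - intros i j a b Ha Hb Hij. exact (S_increasing _ _ _ _ Ha Hb Hij). }
  assert (follows_iff : forall F i, followed (val_graph M S) F i <->
    follows (val F) S (val i)).
  { intros F i. now apply followed_val with (b := gamma). }
  split.
  - intros (G & (G_cond & _ & _ & G_dir & G_dense) & G_union) F HF.
    (* The union of the stems is formed in [V]; by absoluteness of pairs it is the same relation
       when computed through conditions of the model. *)
    assert (G_graph : forall i a, filter_union (fun p => val p ∈ G) i a <->
      val_graph M S i a).
    { intros i a. split.
      - intros (p & s & F' & Hp & Hpp & q & Hq & Hqs).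
        exists (val q). split; [now apply val_pair|]. apply G_union.
        exists (val s), (val F'), (val p). split; [now apply val_pair | auto].
      - intros (q & Hq & HqS). apply G_union in HqS as (s & F' & p & Hp & HpG & Hqs).
        destruct (G_cond p HpG) as (p' & <- & _).
        destruct (val_pair_inv M M_transitive s F' p' Hp) as (s' & F'' & -> & -> & Hp').
        exists p', s', F''. split; auto. split; auto.
        apply val_app; auto. now exists q. }
    destruct (filter_union_follows (inner M) M_ZFC mem_ind omega gammas gamma D
      omega_def gammas_def D_def (fun p => val p ∈ G)) with (F := F)
      as (n & Hn & Hne & Hfol); auto.
    { intros i Hi. destruct (S_total i Hi) as [a Ha]. exists a. now apply G_graph. }
    exists (val n). split; auto. split; [now apply val_nonempty|].
    intros i Hi Hni. destruct (mem_val M M_transitive i omega Hi) as (i' & -> & Hi').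
    apply follows_iff. apply followed_mono with (filter_union (fun p => val p ∈ G)).
    + intros j a. apply G_graph.
    + apply Hfol; auto. intros Hin. destruct Hni as [Hni | Hni].
      * now apply (mem_asym _ mem_ind n i').
      * apply val_inj in Hni. subst. now apply (mem_irrefl _ mem_ind i').
  - intros Hchoice.
    assert (S_follows : forall F, choice_function D F -> exists n, n ∈ omega /\
      nonempty n /\ forall i, i ∈ omega -> i ∉ n -> followed (val_graph M S) F i).
    { intros F HF. destruct (Hchoice F HF) as (n & Hn & Hne & Hfol).
      destruct (mem_val M M_transitive n omega Hn) as (n' & -> & Hn').
      exists n'. split; auto. split; [now apply val_nonempty|].
      intros i Hi Hin. apply follows_iff, Hfol; auto.
      destruct (omega_not_mem _ omega omega_def i n' Hi Hn' Hin) as [H | ->];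
        [now left | now right]. }
    destruct (condition_bound (inner M) M_ZFC omega gammas gamma D
      omega_def gammas_def) as [K HK].
    (* The filter refers to [S], so it is separated in [V] and not in [M]. *)
    destruct (V_separation (val K) (fun v => exists p, v = val p /\
      on_branch omega gammas D (val_graph M S) p)) as [G HG].
    assert (G_iff : forall p : inner M, val p ∈ G <->
      on_branch omega gammas D (val_graph M S) p).
    { intros p. rewrite HG. split.
      - intros (_ & q & Hq & Hb). apply val_inj in Hq. now subst.
      - intros Hb. split; [apply HK, Hb | eauto]. }
    exists G. split.
    + split; [|split; [|split; [|split]]].
      * intros x Hx. apply HG in Hx as (_ & p & -> & Hp). exists p. split; [auto | apply Hp].
      * destruct (omega_zero (inner M) mem_ind omega omega_def) as (z & Hz & _).
        destruct (S_total z Hz) as [a Ha].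
        destruct (on_branch_covers (inner M) M_ZFC mem_ind omega gammas gamma D
          omega_def gammas_def D_def (val_graph M S) S_branch S_follows z a Ha)
          as (p & s & F & Hp & _). exists p. now apply G_iff.
      * intros p q Hp Hq Hqp. apply G_iff. apply G_iff in Hq.
        now apply (on_branch_weaker (inner M) M_ZFC omega gammas D _ p q).
      * intros p q Hp Hq. apply G_iff in Hp, Hq.
        destruct (on_branch_directed (inner M) M_ZFC mem_ind omega gammas gamma D
          omega_def gammas_def D_def (val_graph M S) S_branch p q Hp Hq)
          as (r & Hr & Hrp & Hrq). exists r. split; [now apply G_iff | auto].
      * intros A HA. destruct (on_branch_dense (inner M) M_ZFC mem_ind omega gammas gamma D
          omega_def gammas_def D_def (val_graph M S) S_branch S_follows A HA)
          as (q & Hq & Hb). exists q. split; [auto | now apply G_iff].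
    + intros x. split.
      * intros Hx. destruct (S_pairs x Hx) as (i & a & Hia).
        destruct (S_inner i a) as (i' & a' & -> & -> & Hi'); [now exists x|].
        destruct (on_branch_covers (inner M) M_ZFC mem_ind omega gammas gamma D
          omega_def gammas_def D_def (val_graph M S) S_branch S_follows i' a')
          as (p & s & F & Hp & Hpp & Hs); [now exists x|].
        exists (val s), (val F), (val p). split; [now apply val_pair|].
        split; [now apply G_iff|]. apply val_app in Hs as (y & Hy & Hys); auto.
        now rewrite (pair_unique_ext V _ _ _ _ V_extensionality Hia Hy).
      * intros (s & F & p & Hp & HpG & Hxs). destruct (proj1 (HG p) HpG) as (_ & p' & -> & Hb).
        destruct (val_pair_inv M M_transitive s F p' Hp) as (s' & F' & -> & -> & Hp').
        destruct (mem_val M M_transitive x s' Hxs) as (x' & -> & Hx').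
        destruct Hb as (Hc & s2 & F2 & l & Hp2 & _ & Hs2 & _).
        destruct (pair_inj _ _ _ _ _ _ Hp' Hp2). subst s2 F2.
        destruct Hc as (s2 & F2 & Hp3 & (k & _ & _ & (Hf & _) & _) & _).
        destruct (pair_inj _ _ _ _ _ _ Hp' Hp3). subst s2 F2.
        destruct (Hf x' Hx') as (i & a & Hia).
        destruct (Hs2 i a) as (y & Hy & HyS); [now exists x'|].
        apply val_pair in Hia; auto.
        now rewrite (pair_unique_ext V _ _ _ _ V_extensionality Hia Hy).
Qed.
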